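(* Let $(\Omega\times M,\Theta)$ be a skew product transformation, $\Theta(\omega,x)=(\theta\omega,F_\omega x)$, which is Anosov on fibers and topological mixing on fibers, and which is driven by a uniquely ergodic homeomorphism $(\Omega,\mathbb{P},\theta)$ (precise setting in the context). Assume that $\mathbb{P}(U)>0$ for every nonempty open subset $U$ of $\Omega$. Then for every continuous $\varphi:\Omega\times M\to\mathbb{R}$, the irregular set $I_\varphi$ is either empty or dense in $\Omega\times M$.
   Context: Setting. $M$ is a connected closed smooth Riemannian manifold with induced metric $d_M$; $(\Omega,d_\Omega)$ is a compact metric space; $\theta:\Omega\to\Omega$ is a homeomorphism which is uniquely ergodic, with unique invariant Borel probability measure $\mathbb{P}$ (extended to the completion $\mathcal{B}_{\mathbb{P}}(\Omega)$ of the Borel $\sigma$-algebra). $F:\Omega\to\mathrm{Diff}^2(M)$, $\omega\mapsto F_\omega$, is continuous for the $C^2$-topology. The skew product is $\Theta(\omega,x)=(\theta\omega,F_\omega x)$ and $\Theta^n(\omega,x)=(\theta^n\omega,F_\omega^n x)$ for $n\in\mathbb{Z}$ (so $F_\omega^n=F_{\theta^{n-1}\omega}\circ\cdots\circ F_\omega$ for $n>0$). $\Omega\times M$ carries the metric $d((\omega_1,x_1),(\omega_2,x_2))=d_\Omega(\omega_1,\omega_2)+d_M(x_1,x_2)$. Anosov on fibers: for every $(\omega,x)\in\Omega\times M$ there is a splitting $T_xM_\omega=E^s_{(\omega,x)}\oplus E^u_{(\omega,x)}$ of the tangent space at $x$ of $M_\omega=\{\omega\}\times M$, depending continuously on $(\omega,x)$,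 with $\dim E^s_{(\omega,x)},\dim E^u_{(\omega,x)}>0$, $D_xF_\omega E^{u}_{(\omega,x)}=E^{u}_{\Theta(\omega,x)}$, $D_xF_\omega E^{s}_{(\omega,x)}=E^{s}_{\Theta(\omega,x)}$, and a constant $\lambda_0>0$ such that $|D_xF_\omega\xi|\geq e^{\lambda_0}|\xi|$ for all $\xi\in E^u_{(\omega,x)}$ and $|D_xF_\omega\eta|\leq e^{-\lambda_0}|\eta|$ for all $\eta\in E^s_{(\omega,x)}$. Topological mixing on fibers: for any nonempty open $U,V\subset M$ there is $N>0$ such that for all $n\geq N$ and all $\omega\in\Omega$, $\Theta^n(\{\omega\}\times U)\cap(\{\theta^n\omega\}\times V)\neq\varnothing$. Irregular set: $I_\varphi=\{(\omega,x)\in\Omega\times M:\lim_{n\to\infty}\frac1n\sum_{i=0}^{n-1}\varphi(\Theta^i(\omega,x))\text{ does not exist}\}$. *)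

(* Defs.v *)
From HB Require Import structures.
From mathcomp Require Import all_boot all_order all_algebra.
From mathcomp Require Import all_classical all_reals all_analysis.

Set Implicit Arguments.
Unset Strict Implicit.
Unset Printing Implicit Defensive.

Import Order.TTheory GRing.Theory Num.Theory.
Import numFieldNormedType.Exports.

Local Open Scope classical_set_scope.
Local Open Scope ring_scope.

(* [Ck_on k U f] is the usual notion of C^k map when [U] is open and [V] is
   finite dimensional. *)
Fixpoint Ck_on (R : realType) (V W : normedModType R) (k : nat) (U : set V)
    (f : V -> W) : Prop :=
  match k with
  | 0 => forall x, U x -> {for x, continuous f}
  | k'.+1 => (forall x, U x -> differentiable f x) /\
             (forall v, Ck_on k' U (fun x => 'd f x v))
  end.

Definition smooth_on (R : realType) (V W : normedModType R) (U : set V)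
    (f : V -> W) := forall k, Ck_on k U f.

(* [Ck_close k K e f g]: all partial derivatives of [f] and [g] of order at
   most [k] differ by less than [e] at every point of [K]. *)
Fixpoint Ck_close (R : realType) (n : nat) (W : normedModType R) (k : nat)
    (K : set 'rV[R]_n) (e : R) (f g : 'rV[R]_n -> W) : Prop :=
  (forall y, K y -> `|f y - g y| < e) /\
  match k with
  | 0 => True
  | k'.+1 => forall i : 'I_n,
      Ck_close k' K e (fun y => 'd f y (delta_mx 0 i))
                      (fun y => 'd g y (delta_mx 0 i))
  end.

(* Charts take values in open subsets of R^n, so manifolds have no boundary.
   [chart_map] and [chart_inv] are total, with irrelevant values outside
   [chart_dom] and [chart_cod]. *)
Record chart (R : realType) (M : topologicalType) (n : nat) := Chart {
  chart_map :> M -> 'rV[R]_n;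
  chart_inv : 'rV[R]_n -> M;
  chart_dom : set M;
  chart_cod : set 'rV[R]_n;
  open_chart_dom : open chart_dom;
  open_chart_cod : open chart_cod;
  chart_dom_cod : forall x, chart_dom x -> chart_cod (chart_map x);
  chart_cod_dom : forall y, chart_cod y -> chart_dom (chart_inv y);
  chart_mapK : forall x, chart_dom x -> chart_inv (chart_map x) = x;
  chart_invK : forall y, chart_cod y -> chart_map (chart_inv y) = y;
  chart_map_continuous : forall x, chart_dom x -> {for x, continuous chart_map};
  chart_inv_continuous : forall y, chart_cod y -> {for y, continuous chart_inv}
}.

(* Each point [x] gets a preferred chart [chart_at x] of the atlas.  The tangent
   space at [x] is represented by 'rV[R]_n, a vector standing for the tangent
   vector with these coordinates in [chart_at x].  Nothing is required of the
   dependence of [chart_at x] on [x]. *)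
Record smooth_structure (R : realType) (M : topologicalType) (n : nat) :=
  SmoothStructure {
  atlas : set (chart R M n);
  chart_at : M -> chart R M n;
  chart_at_atlas : forall x, atlas (chart_at x);
  chart_at_dom : forall x, chart_dom (chart_at x) x;
  transition_smooth : forall c c', atlas c -> atlas c' ->
    smooth_on (c @` (chart_dom c `&` chart_dom c')) (c' \o chart_inv c)
}.

Section Manifold.
Context (R : realType) (M : topologicalType) (n : nat).
Variable S : smooth_structure R M n.

Definition Ck_map (k : nat) (f : M -> M) :=
  continuous f /\
  forall c c', atlas S c -> atlas S c' ->
    Ck_on k (c @` (chart_dom c `&` f @^-1` chart_dom c'))
            (c' \o f \o chart_inv c).

Definition tangent_map (f : M -> M) (x : M) : 'End('rV[R]_n) :=
  linfun ('d (chart_at S (f x) \o f \o chart_inv (chart_at S x))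
             (chart_at S x x)).

(* Coordinates in the chart [c] of the tangent vectors at [x]. *)
Definition tangent_coord (c : chart R M n) (x : M) : 'End('rV[R]_n) :=
  linfun ('d (c \o chart_inv (chart_at S x)) (chart_at S x x)).

(* The tangent vectors at [x] as a function of their coordinates in [c]. *)
Definition tangent_of_coord (c : chart R M n) (x : M) : 'End('rV[R]_n) :=
  linfun ('d (chart_at S x \o chart_inv c) (c x)).

Record diff2 := Diff2 {
  diff2_map :> M -> M;
  diff2_inv : M -> M;
  diff2_mapK : cancel diff2_map diff2_inv;
  diff2_invK : cancel diff2_inv diff2_map;
  diff2_map_C2 : Ck_map 2 diff2_map;
  diff2_inv_C2 : Ck_map 2 diff2_inv
}.

HB.instance Definition _ := gen_eqMixin diff2.
HB.instance Definition _ := gen_choiceMixin diff2.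

Definition C2_subbasic (f : diff2) (c c' : chart R M n) (K : set M) (e : R) :
    set diff2 :=
  [set g : diff2 | g @` K `<=` chart_dom c' /\
     Ck_close 2 (c @` K) e (c' \o f \o chart_inv c) (c' \o g \o chart_inv c)].

(* Since only closed manifolds are considered, the weak and the strong C^2
   topologies coincide. *)
Definition C2_subbase : set (set diff2) :=
  [set N | exists (f : diff2) (c c' : chart R M n) (K : set M) (e : R),
    [/\ atlas S c /\ atlas S c', compact K,
        K `<=` chart_dom c /\ f @` K `<=` chart_dom c', 0 < e &
        N = C2_subbasic f c c' K e]].

HB.instance Definition _ := isSubBaseTopological.Build diff2 C2_subbase id.

(* [gram x] is the Gram matrix of the inner product on the tangent space at
   [x]. *)
Record riemannian_metric := RiemannianMetric {
  gram : M -> 'M[R]_n;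
  gram_sym : forall x, (gram x)^T = gram x;
  gram_pos : forall x (v : 'rV[R]_n), v != 0 -> 0 < (v *m gram x *m v^T) 0 0;
  gram_smooth : forall c, atlas S c -> forall u v : 'rV[R]_n,
    smooth_on (chart_cod c) (fun y : 'rV[R]_n =>
      let x := chart_inv c y in
      (tangent_of_coord c x u *m gram x *m (tangent_of_coord c x v)^T) 0 0 : R)
}.

Variable g : riemannian_metric.

Definition tangent_norm (x : M) (v : 'rV[R]_n) : R :=
  Num.sqrt ((v *m gram g x *m v^T) 0 0).

Definition C1_curve (gamma : R -> M) :=
  continuous gamma /\
  forall c, atlas S c -> Ck_on 1 (gamma @^-1` chart_dom c) (c \o gamma).

Definition velocity (gamma : R -> M) (t : R) : 'rV[R]_n :=
  derive1 (chart_at S (gamma t) \o gamma) t.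

Definition curve_length (gamma : R -> M) : R :=
  \int[lebesgue_measure]_(t in `[0, 1]) tangent_norm (gamma t) (velocity gamma t).

(* Curves may have zero velocity: a piecewise C^1 curve on [0, 1] can be
   reparametrized, with the same length, so as to stop at its corners and at
   both ends, and it is then the restriction of a C^1 curve defined on R. *)
Definition riemannian_distance (x y : M) : R :=
  inf [set curve_length gamma | gamma in
        [set gamma | [/\ C1_curve gamma, gamma 0 = x & gamma 1 = y]]].

End Manifold.

(* Borel measures live on [g_sigma_algebraType], which needs a pointed type. *)
#[short(type="pmetricType")]
HB.structure Definition PointedMetric (K : numDomainType) :=
  {T of Metric K T & isPointed T}.

Definition borel (T : ptopologicalType) := g_sigma_algebraType (@open T).

Definition homeomorphism (T : topologicalType) (f : T -> T) :=
  continuous f /\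
  exists h : T -> T, [/\ cancel f h, cancel h f & continuous h].

Definition invariant_measure (R : realType) (T : ptopologicalType)
    (f : T -> T) (P : probability (borel T) R) :=
  forall A : set (borel T), measurable A -> P (f @^-1` A) = P A.

Definition uniquely_ergodic (R : realType) (T : ptopologicalType)
    (f : T -> T) (P : probability (borel T) R) :=
  invariant_measure f P /\
  forall Q : probability (borel T) R, invariant_measure f Q ->
    forall A : set (borel T), measurable A -> Q A = P A.

Section SkewProduct.
Context (R : realType) (M : topologicalType) (n : nat).
Variables (S : smooth_structure R M n) (g : riemannian_metric S).
Variables (Omega : topologicalType) (theta : Omega -> Omega).
Variable F : Omega -> diff2 S.

Definition skew (p : Omega * M) : Omega * M := (theta p.1, F p.1 p.2).

(* Near each [p0], in the fixed chart [chart_at S p0.2], the subspaces [E p]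
   have a basis depending continuously on [p]. *)
Definition continuous_subbundle (E : Omega * M -> {vspace 'rV[R]_n}) :=
  forall p0 : Omega * M, exists (k : nat) (e : 'I_k -> Omega * M -> 'rV[R]_n),
    \forall p \near p0,
      (forall i, {for p, continuous (e i)}) /\
      basis_of (tangent_coord S (chart_at S p0.2) p.2 @: E p)%VS
               [tuple e i p | i < k].

Definition anosov_on_fibers :=
  exists (Es Eu : Omega * M -> {vspace 'rV[R]_n}) (lambda0 : R),
    [/\ continuous_subbundle Es /\ continuous_subbundle Eu,
        forall p, [/\ (Es p :&: Eu p = 0)%VS, (Es p + Eu p = fullv)%VS,
                      (0 < \dim (Es p))%N & (0 < \dim (Eu p))%N],
        forall p, (tangent_map S (F p.1) p.2 @: Eu p = Eu (skew p))%VS /\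
                  (tangent_map S (F p.1) p.2 @: Es p = Es (skew p))%VS,
        0 < lambda0 &
        forall p,
          (forall xi, xi \in Eu p ->
             expR lambda0 * tangent_norm g p.2 xi
             <= tangent_norm g (skew p).2 (tangent_map S (F p.1) p.2 xi)) /\
          (forall eta, eta \in Es p ->
             tangent_norm g (skew p).2 (tangent_map S (F p.1) p.2 eta)
             <= expR (- lambda0) * tangent_norm g p.2 eta)].

Definition mixing_on_fibers :=
  forall U V : set M, open U -> U !=set0 -> open V -> V !=set0 ->
    exists2 N : nat, (0 < N)%N & forall m, (N <= m)%N -> forall omega,
      (iter m skew @` ([set omega] `*` U))
        `&` ([set iter m theta omega] `*` V) !=set0.

Definition irregular_set (phi : Omega * M -> R) : set (Omega * M) :=
  [set p | ~ cvgn (fun m : nat =>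
                     m%:R^-1 * \sum_(0 <= i < m) phi (iter i skew p))].

End SkewProduct.

(* Main.v *)
(** The orbit of [theta] through any point is dense: otherwise averaging along
    it would give an invariant probability vanishing on a nonempty open set,
    hence different from the fully supported [P].  Let [p0] be an irregular
    point and [O] an open set.  By density some iterate of [p0] lies over the
    base projection of [O], and by mixing one may start in [O] over the same
    base point and land, after [m] steps, arbitrarily close to the orbit of
    [p0].  Following it from then on gives a pseudo-orbit over a true orbit of
    [theta].  Hyperbolicity on fibers yields a true orbit shadowing it (a
    contraction argument in finitely many charts for finite pseudo-orbits, then
    compactness of [M]), which starts in [O] and stays close to that of [p0].
    Since [phi] is uniformly continuous, its averages oscillate as well: the
    oscillation of those along [p0] fixes the required precision. *)

From HB Require Import structures.
Require Import Defs.
From mathcomp Require Import all_boot all_order all_algebra.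
From mathcomp Require Import all_classical all_reals all_analysis.
From mathcomp Require Import ring lra zify.
Set Implicit Arguments.
Unset Strict Implicit.
Unset Printing Implicit Defensive.
Import Order.TTheory GRing.Theory Num.Theory.
Import numFieldNormedType.Exports.
Local Open Scope classical_set_scope.
Local Open Scope ring_scope.

(** * Density of orbits *)

(** Averaging along one orbit, with no convergence known, yields only a finitely additive mean on
    all subsets. Countable additivity comes from an outer measure built on open covers. This can
    lower the mass of an open set, but [Q U <= m U] is all that is used, and compactness keeps the
    total mass 1. The obstacle in the shadowing is that the derivative at a point of a pseudo-orbit
    carries the splitting there to the splitting at its image, not at the next point, whereas the
    linear theory wants exact invariance. The derivative is therefore composed with a map close to
    the identity that matches the two splittings. Its distance to the identity joins the nonlinear
    error, and its distortion of the norms is paid for with half of the exponent, so that the rate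
    is [expR (- (lambda / 2))] instead of [expR (- lambda)]. Finite pseudo-orbits put the
    contraction in a space of matrices, with constants that do not depend on the length. Jumps are
    confined to fibers, so the shadowing orbit lies over the same orbit of [theta]. *)

Section InvariantMean.
Context (R : realType) (T : Type) (f : T -> T) (x : T).

(** With [n.+1] terms, [frequency setT] is 1 for every [n]. *)
Definition frequency (A : set T) (n : nat) : R :=
  n.+1%:R^-1 * \sum_(0 <= i < n.+1) \1_A (iter i f x).

Lemma frequency_itv A n : 0 <= frequency A n <= 1.
Proof.
rewrite mulr_ge0 ?invr_ge0// ?sumr_ge0//=; last first.
rewrite ler_pdivrMl// mulr1 -[leRHS](_ : \sum_(0 <= i < n.+1) 1 = _).
  by apply: ler_sum => i _; rewrite indicE; case: (_ \in _).
by rewrite big_const_nat subn0 iter_addr_0.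
Qed.

Lemma frequencyU A B n : A `&` B = set0 ->
  frequency (A `|` B) n = frequency A n + frequency B n.
Proof.
move=> AB; rewrite -mulrDr -big_split/=; congr (_ * _).
apply: eq_bigr => i _; have := congr1 (fun C => iter i f x \in C) AB.
rewrite !indicE in_setI in_setU in_set0.
by do 2 case: (_ \in _) => //=; rewrite ?addr0 ?add0r.
Qed.

(** Taking the preimage shifts the orbit by one step, so the two sums differ by their end terms
    only. *)
Lemma frequency_preimage A n :
  `|frequency (f @^-1` A) n - frequency A n| <= n.+1%:R^-1.
Proof.
have E i : \1_(f @^-1` A) (iter i f x) = \1_A (iter i.+1 f x) :> R.
  by rewrite !indicE.
rewrite -mulrBr normrM ger0_norm ?invr_ge0// -[leRHS]mulr1 ler_wpM2l ?invr_ge0//.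
rewrite (eq_bigr _ (fun i _ => E i)) -sumrB telescope_sumr//.
rewrite !indicE; do 2 case: (_ \in _);
  by rewrite ?subrr ?subr0 ?sub0r ?normrN ?normr1 ?normr0.
Qed.

(** A Banach limit: along an ultrafilter finer than [\oo] the frequencies of all sets converge at
    once. *)
Lemma invariant_mean : exists m : set T -> R,
  [/\ forall A, 0 <= m A, m setT = 1,
      forall A B, A `&` B = set0 -> m (A `|` B) = m A + m B,
      forall A, m (f @^-1` A) = m A &
      forall A, (forall n, ~ A (iter n f x)) -> m A = 0].
Proof.
have [U [UU infU]] := ultraFilterLemma (eventually_filter).
have UP : ProperFilter U by apply: ultra_proper.
(* A cluster point of an ultrafilter is a limit, since the ultrafilter contains each preimage or its
   complement. *)
have cvU A : cvg (frequency A n @[n --> U]).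
  have : compact `[0, 1 : R]%classic by exact: segment_compact.
  move=> /(_ (frequency A n @[n --> U]) _)[].
    apply: (@filterE _ U) => n; rewrite /= in_itv/=; exact: frequency_itv.
  move=> l [_ ll]; apply/cvg_ex; exists l => B lB.
  have [//|nB] := in_ultra_setVsetC (frequency A @^-1` B) UU.
  by have [y []] := ll (~` B) B nB lB.
exists (fun A => lim (frequency A n @[n --> U])); split.
- move=> A; apply: limr_ge => //; apply: filterE => n.
  by have /andP[] := frequency_itv A n.
- rewrite (_ : frequency setT = cst 1); first exact: lim_cst.
  apply/funext => n; rewrite /frequency (eq_bigr (fun=> 1)); last first.
    by move=> i _; rewrite indicT.
  by rewrite big_const_nat subn0 iter_addr_0 mulVf.
- move=> A B AB; apply: cvg_lim => //.
  rewrite (_ : frequency (A `|` B) = frequency A \+ frequency B).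
    by apply: cvgD; [exact: cvU|exact: cvU].
  by apply/funext => n; exact: frequencyU.
- move=> A; apply/eqP; rewrite -subr_eq0 -limB//; apply/eqP.
  apply: cvg_lim => //; apply/cvgr0Pnorm_lt => e e0.
  apply: infU; near=> n; rewrite (le_lt_trans (frequency_preimage _ _))//.
  by near: n; exact: (near_infty_natSinv_lt (PosNum e0)).
- move=> A nA; rewrite (_ : frequency A = cst 0); first exact: lim_cst.
  apply/funext => n; rewrite /frequency big1 ?mulr0// => i _.
  by rewrite indicE memNset.
Unshelve. all: by end_near. Qed.

End InvariantMean.

(** * From a finitely additive mean to an invariant Borel probability *)

Section BorelMeasureOfMean.
Context (R : realType) (T : pmetricType R) (m : set T -> R).
Hypothesis T_compact : compact [set: T].
Hypothesis m_ge0 : forall A, 0 <= m A.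
Hypothesis mT : m setT = 1.
Hypothesis mU : forall A B, A `&` B = set0 -> m (A `|` B) = m A + m B.

Lemma mean0 : m set0 = 0.
Proof. by apply: (addrI (m set0)); rewrite -mU ?setUid ?setI0// addr0. Qed.

Lemma meanD A B : A `<=` B -> m (B `\` A) = m B - m A.
Proof.
move=> AB; apply/eqP; rewrite eq_sym subr_eq addrC -mU ?setDIK//.
by rewrite setDUK.
Qed.

Lemma mean_le A B : A `<=` B -> m A <= m B.
Proof. by move=> AB; rewrite -subr_ge0 -meanD. Qed.

Lemma mean_le1 A : m A <= 1.
Proof. by rewrite -mT mean_le. Qed.

Lemma meanU_le A B : m (A `|` B) <= m A + m B.
Proof.
rewrite -(setDUK (@subsetUl _ A B)) mU ?setDIK// lerD2l mean_le//.
by move=> x [[]].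
Qed.

(* Borel sets are not yet available: the generated sigma-algebra is only a means
   of getting every set measurable, and non-open sets are given infinite weight
   so that only open covers count in [mean_ext]. *)
Definition mean_open (A : set (g_sigma_algebraType [set: set T])) : \bar R :=
  if `[< open (A : set T) >] then (m A)%:E else +oo%E.

Lemma mean_open0 : mean_open set0 = 0%E.
Proof. by rewrite /mean_open asboolT ?mean0//; exact: open0. Qed.

Lemma mean_open_ge0 A : (0 <= mean_open A)%E.
Proof. by rewrite /mean_open; case: asboolP => // _; rewrite lee_fin. Qed.

Definition mean_ext : set T -> \bar R := mu_ext mean_open.

HB.instance Definition _ := isOuterMeasure.Build R T mean_ext
  (mu_ext0 mean_open0 mean_open_ge0) (mu_ext_ge0 mean_open_ge0)
  (@le_mu_ext _ _ _ mean_open) (mu_ext_sigma_subadditive mean_open_ge0).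

(** Cover [A] by itself and empty sets. Equality may fail, as a mean can charge [A] with mass
    escaping to its boundary. *)
Lemma mean_ext_open A : open A -> (mean_ext A <= (m A)%:E)%E.
Proof.
move=> oA; apply: ereal_inf_lbound; exists (fun i => if i is 0%N then A else set0).
  split; first by move=> i; exact: sub_sigma_algebra.
  by move=> x Ax; exists 0%N.
rewrite nneseries_recl//; last by move=> k _; exact: mean_open_ge0.
rewrite eseries0 ?adde0 => [|[|k]]//; last first.
  by rewrite mean_open0.
by rewrite /mean_open asboolT.
Qed.

(** By compactness a countable open cover has a finite subcover, to which finite subadditivity of
    [m] applies. *)
Lemma mean_extT : mean_ext setT = 1%E.
Proof.
apply/eqP; rewrite eq_le; apply/andP; split.
  by rewrite -mT mean_ext_open//; exact: openT.
apply: le_ereal_inf_tmp => _ [F [_ FT] <-].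
have [[k nk]|/forallNP Fo] := pselect (exists k, ~ open (F k : set T)).
  rewrite (eseries_pinfty _ _ (k := k))//.
  + by rewrite leey.
  + by move=> i _; rewrite gt_eqF// (lt_le_trans _ (mean_open_ge0 _)).
  + by rewrite /mean_open asboolF.
have {}Fo k : open (F k : set T) by apply: contrapT; exact: Fo.
pose G n := \bigcup_(i in `I_n) (F i : set T).
have [n Gn] : exists n, G n = setT.
  have /compact_near_coveringP/(_ nat \oo (fun n x => G n x) _)[] := T_compact.
    move=> x _; have [k _ Fkx] := FT x I.
    exists (F k : set T, [set n | (k < n)%N]).
      by split; [apply: open_nbhs_nbhs; split => //; exact: Fo|exists k.+1].
    by move=> [y n] /= [Fky kn]; exists k.
  move=> n _ /(_ n (leqnn n)) nT; exists n.
  by rewrite -subTset.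
rewrite -mT -Gn; apply: (@le_trans _ _ (\sum_(0 <= i < n) mean_open (F i))%E).
  elim: n {Gn} => [|n IH]; first by rewrite big_geq// /G bigcup0// mean0.
  rewrite big_nat_recr//= (_ : G n.+1 = G n `|` F n).
    rewrite (le_trans _ (leeD2r _ IH))// /mean_open asboolT// -EFinD lee_fin.
    exact: meanU_le.
  by rewrite /G IIS bigcup_setU bigcup_set1.
by apply: nneseries_lim_ge => *; exact: mean_open_ge0.
Qed.

(** A radius strictly above [r] is required so that this set is open. *)
Let inner (H : set T) (r : R) : set T :=
  [set x | exists2 s, r < s & ball x s `<=` H].

Let inner_open H r : open (inner H r).
Proof.
rewrite openE => x [s rs xs]; apply/nbhs_ballP; exists ((s - r) / 2) => /=.
  by rewrite divr_gt0// subr_gt0.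
move=> y xy; exists (s - (s - r) / 2); first lra.
move=> z yz; apply: xs; rewrite (_ : s = (s - r) / 2 + (s - (s - r) / 2)); last lra.
exact: ball_triangle yz.
Qed.

Let inner_closure H r r' : 0 < r' -> r' < r -> closure (inner H r) `<=` inner H r'.
Proof.
move=> r'0 r'r x /(_ (ball x ((r - r') / 2)))[].
  by apply: nbhsx_ballx; rewrite divr_gt0// subr_gt0.
move=> y [[s rs ys] xy]; exists (s - (r - r') / 2); first lra.
move=> z xz; apply: ys; rewrite (_ : s = (r - r') / 2 + (s - (r - r') / 2)); last lra.
exact: ball_triangle (ball_sym xy) xz.
Qed.

Let inner_sub H r : 0 < r -> inner H r `<=` H.
Proof.
by move=> r0 x [s rs]; apply; apply: ballxx; exact: lt_trans rs.
Qed.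

(* The shells between consecutive sets of an exhaustion of [H] have summable
   masses, because shells at distance two are disjoint. *)
Lemma mean_ext_inner_regular H e : open H -> 0 < e ->
  exists V, [/\ open V, closure V `<=` H & (mean_ext H <= (m V + e)%:E)%E].
Proof.
move=> oH e0.
pose V n := inner H (n.+1%:R^-1).
have V_S n : closure (V n) `<=` V n.+1.
  by apply: inner_closure; rewrite ?invr_gt0// ltf_pV2 ?posrE// ltr_nat.
have V_S' n : V n `<=` V n.+1 by apply: subset_trans (V_S n); exact: subset_closure.
have cvV : cvg (m (V n) @[n --> \oo]).
  apply: nondecreasing_is_cvgn.
    by apply/nondecreasing_seqP => n; exact: mean_le.
  by exists 1 => _ [n _ <-]; exact: mean_le1.
set l := limn (fun n => m (V n)).
have Vl n : m (V n) <= l.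
  apply: nondecreasing_cvgn_le => //.
  by apply/nondecreasing_seqP => k; exact: mean_le.
have [N Ne] : exists N, l - e / 2 < m (V N).
  have /cvgrPdist_lt/(_ (e / 2)) := cvV; rewrite divr_gt0// => /(_ isT)[N _ /(_ N)].
  by rewrite /= leqnn => /(_ isT); rewrite ltr_distlC => /andP[? _]; exists N.
exists (V N.+1); split; first exact: inner_open.
  by apply: subset_trans (V_S N.+1) _; apply: inner_sub; rewrite invr_gt0.
pose W i := V (N + i).+2 `\` closure (V (N + i)%N).
(* A point of [H] outside [V N.+1] lies in the shell of the first level that contains it. *)
have HW : H `<=` V N.+1 `|` \bigcup_i W i.
  move=> x Hx.
  have [n Vnx] : exists n, V (N + n).+1 x.
    have : nbhs x H by apply: open_nbhs_nbhs.
    rewrite -nbhs_ballE => -[s /= s0 xs].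
    have [n] : exists n, (N + n).+2%:R^-1 < s.
      have [N' _ /(_ (N + N').+1)] := near_infty_natSinv_lt (PosNum s0).
      by rewrite /= -addSn leq_addl => /(_ isT); exists N'.
    by exists n, s.
  elim: n Vnx => [|n IH]; first by rewrite addn0; left.
  have [/IH//|nVn] := pselect (V (N + n).+1 x); rewrite addnS => Vx.
  by right; exists n => //; split => // /V_S.
have mW i : m (W i) <= m (V (N + i).+2) - m (V (N + i)%N).
  rewrite -meanD; last by apply: subset_trans (V_S' _).
  by apply: mean_le => x [Vx nc]; split => // /subset_closure.
apply: (le_trans (le_outer_measure mean_ext _ _ HW)).
rewrite (le_trans (outer_measureU2 _ _ _))// EFinD leeD//.
  by apply: mean_ext_open; exact: inner_open.
apply: (le_trans (outer_measure_sigma_subadditive mean_ext W)).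
apply: lime_le; first by apply: is_cvg_nneseries => i _ _; exact: outer_measure_ge0.
apply: nearW => n.
apply: (@le_trans _ _ (\sum_(0 <= i < n) (m (W i))%:E)%E).
  apply: lee_sum => i _; apply: mean_ext_open; rewrite /W setDE.
  by apply: openI; [exact: inner_open|exact/closed_openC/closed_closure].
rewrite sumEFin lee_fin.
(* The differences in [mW] skip one index, so their sum telescopes to two end differences, each at
   most [e / 2] by the choice of [N]. *)
have : \sum_(0 <= i < n) m (W i) <=
    (m (V (N + n).+1) - m (V N.+1)) + (m (V (N + n)%N) - m (V N)).
  elim: n => [|n IH]; first by rewrite big_geq// addn0 !subrr addr0.
  rewrite big_nat_recr//= addnS; have := mW n; move: IH; lra.
have := Vl (N + n).+1; have := Vl (N + n)%N.
have := mean_le (V_S' N); lra.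
Qed.

Lemma mean_ext_caratheodory_open G : open G -> mean_ext.-caratheodory G.
Proof.
move=> oG; apply: le_caratheodory_measurable => X.
(* Inner regularity provides [V] in the intersection of [O] and [G]. The part of [O] off [closure V]
   is open, disjoint from [V], and covers the rest. Arbitrary sets follow by splitting each member
   of an open cover. *)
have splitO O : open O -> (mean_ext (O `&` G) + mean_ext (O `\` G) <= (m O)%:E)%E.
  move=> oO; apply/lee_addgt0Pr => e e0.
  have [V [oV VG le]] := mean_ext_inner_regular (openI oO oG) e0.
  have oC : open (O `\` closure V).
    by rewrite setDE; apply: openI => //; exact/closed_openC/closed_closure.
  apply: (@le_trans _ _ ((m V + e)%:E + (m (O `\` closure V))%:E)%E).
    apply: leeD => //; apply: le_trans (mean_ext_open oC).
    by apply: le_outer_measure => x [Ox nGx]; split => // /VG[].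
  rewrite -!EFinD lee_fin -addrA [e + _]addrC addrA lerD2r -mU.
    by apply: mean_le => x [/subset_closure/VG[]|[]].
  by rewrite -subset0 => x [/subset_closure Vx []].
apply: le_ereal_inf_tmp => _ [F [_ XF] <-].
have : (mean_ext (X `&` G) + mean_ext (X `&` ~` G) <=
    \sum_(i <oo) mean_ext (F i `&` G) + \sum_(i <oo) mean_ext (F i `\` G))%E.
  apply: leeD.
    apply: le_trans (outer_measure_sigma_subadditive mean_ext (fun i => F i `&` G)).
    by apply: le_outer_measure => x [/XF[i _ Fx] Gx]; exists i.
  apply: le_trans (outer_measure_sigma_subadditive mean_ext (fun i => F i `\` G)).
  by apply: le_outer_measure => x [/XF[i _ Fx] Gx]; exists i.
move=> /le_trans; apply; rewrite -nneseriesD; last 2 first.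
- by move=> i _ _; exact: outer_measure_ge0.
- by move=> i _ _; exact: outer_measure_ge0.
apply: lee_nneseries => i _; first by rewrite adde_ge0// outer_measure_ge0.
by rewrite /mean_open; case: asboolP => [/splitO//|_]; rewrite leey.
Qed.

Lemma mean_ext_caratheodory (A : set (borel T)) :
  measurable A -> mean_ext.-caratheodory A.
Proof.
(* Measurability in [borel T] is membership in every sigma-algebra containing the open sets, in
   particular in that of Caratheodory. *)
move=> mA; apply: mA; split; last exact: mean_ext_caratheodory_open.
split.
- exact: caratheodory_measurable_set0.
- by move=> B mB; rewrite setTD; exact: caratheodory_measurable_setC.
- by move=> F mF; exact: caratheodory_measurable_bigcup.
Qed.

Definition mean_measure (A : set (borel T)) : \bar R := mean_ext A.

Let mean_measure_sigma_additive : semi_sigma_additive mean_measure.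
Proof.
move=> F mF tF mUF.
by apply: (@caratheodory_measure_sigma_additive _ _ mean_ext) => //;
  [move=> i|]; exact: mean_ext_caratheodory.
Qed.

HB.instance Definition _ := isMeasure.Build _ _ R mean_measure
  (outer_measure0 mean_ext) (outer_measure_ge0 mean_ext)
  mean_measure_sigma_additive.

HB.instance Definition _ := Measure_isProbability.Build _ _ R mean_measure
  mean_extT.

(** Preimages of an open cover form an open cover with the same masses. Applied to a homeomorphism
    and to its inverse, this gives invariance. *)
Lemma mean_ext_preimage_le (f : T -> T) A : continuous f ->
  (forall B, m (f @^-1` B) = m B) -> (mean_ext (f @^-1` A) <= mean_ext A)%E.
Proof.
move=> cf mf; apply: le_ereal_inf_tmp => _ [F [_ AF] <-].
apply: ge_ereal_inf => /=; exists (\sum_(k <oo) mean_open (f @^-1` F k))%E.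
  exists (fun k => f @^-1` F k) => //; split.
    by move=> k; exact: sub_sigma_algebra.
  by move=> x /AF[k _ Fx]; exists k.
apply: lee_nneseries => [*|k _]; first exact: mean_open_ge0.
rewrite {2}/mean_open; case: asboolP => [oF|_]; last by rewrite leey.
rewrite /mean_open asboolT ?mf//.
by apply: open_comp => // x _; exact: cf.
Qed.

Lemma mean_measure_exists : exists Q : probability (borel T) R,
  (forall U : set T, open U -> (Q U <= (m U)%:E)%E) /\
  forall f : T -> T, homeomorphism f -> (forall B, m (f @^-1` B) = m B) ->
    invariant_measure f Q.
Proof.
exists mean_measure; split => [|f [cf [h [fK hK ch]]] mf A _]; first exact: mean_ext_open.
apply/eqP; rewrite eq_le mean_ext_preimage_le//= /mean_measure.
rewrite [X in (mean_ext X <= _)%E](_ : _ = h @^-1` (f @^-1` A)).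
  apply: mean_ext_preimage_le => // B; rewrite -mf; congr (m _).
  by apply/seteqP; split=> x; rewrite /preimage/= fK.
by apply/seteqP; split=> x; rewrite /preimage/= hK.
Qed.

End BorelMeasureOfMean.

Lemma uniquely_ergodic_minimal (R : realType) (T : pmetricType R) (f : T -> T)
    (P : probability (borel T) R) : compact [set: T] -> homeomorphism f ->
  uniquely_ergodic f P -> (forall U : set T, open U -> U !=set0 -> (0 < P U)%E) ->
  forall x (U : set T), open U -> U !=set0 -> exists n, U (iter n f x).
Proof.
move=> cT hf [_ ue] full x U oU U0; apply: contrapT => /forallNP nU.
have [m [m0 mT mU mf /(_ _ nU) mU0]] := invariant_mean R f x.
have [Q [QU /(_ f hf mf) Qf]] := mean_measure_exists cT m0 mT mU.
have := full U oU U0; rewrite -(ue Q)//; last exact: sub_sigma_algebra.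
by apply/negP; rewrite -leNgt (le_trans (QU _ _))// mU0.
Qed.

(** * Shadowing for sequences of hyperbolic linear maps *)

(* Redeclaring completeness makes matrices a [completeNormedModType], which the
   library does not infer. *)
HB.instance Definition _ (R : realType) m n :=
  Uniform_isComplete.Build 'M[R]_(m, n) (@cauchy_cvg _).

Lemma ler_mx_norm_coord (R : realType) m n (A : 'M[R]_(m, n)) i j :
  `|A i j| <= `|A|.
Proof.
rewrite [`|A|]mx_normrE.
by apply: (le_bigmax _ (fun ij => `|A ij.1 ij.2|) (i, j)).
Qed.

Lemma mx_norm_leP (R : realType) m n (A : 'M[R]_(m, n)) (c : R) : 0 <= c ->
  (forall i j, `|A i j| <= c) -> `|A| <= c.
Proof. by move=> c0 Ac; rewrite [`|A|]mx_normrE; apply: bigmax_le. Qed.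

Lemma ler_norm_row (R : realType) m n (A : 'M[R]_(m, n)) i : `|row i A| <= `|A|.
Proof.
by apply: mx_norm_leP => // k j; rewrite mxE; exact: ler_mx_norm_coord.
Qed.

Lemma norm_rows_le (R : realType) m n (A : 'M[R]_(m, n)) (c : R) : 0 <= c ->
  (forall i, `|row i A| <= c) -> `|A| <= c.
Proof.
move=> c0 Ac; apply: mx_norm_leP => // i j.
by have := ler_mx_norm_coord (row i A) 0 j; rewrite mxE => /le_trans; apply.
Qed.

Section Shadowing.
Context (R : realType) (n : nat).
Local Notation V := 'rV[R]_n.
Context (P A : nat -> 'End(V)) (nu : nat -> V -> R) (C mu : R).
Hypothesis C_gt0 : 0 < C.
Hypothesis mu_ge0 : 0 <= mu.
Hypothesis mu_lt1 : mu < 1.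
Hypothesis P_proj : forall k v, P k (P k v) = P k v.
Hypothesis P_le : forall k v, `|P k v| <= C * `|v|.
Hypothesis nu_triangle : forall k u v, nu k (u + v) <= nu k u + nu k v.
Hypothesis nu_ge : forall k v, `|v| <= C * nu k v.
Hypothesis nu_le : forall k v, nu k v <= C * `|v|.
Hypothesis stable : forall k v, P k v = v ->
  P k.+1 (A k v) = A k v /\ nu k.+1 (A k v) <= mu * nu k v.
Hypothesis unstable : forall k v, P k v = 0 ->
  P k.+1 (A k v) = 0 /\ nu k v <= mu * nu k.+1 (A k v).
Hypothesis unstable_onto : forall k w, P k.+1 w = 0 ->
  exists2 v, P k v = 0 & A k v = w.

(** The inverse of a linear map is here a generalized one, correct on its image. The factors
    [\1 - P k] confine it to the unstable space, which is the kernel of [P k]. *)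
Definition unstable_inv k : 'End(V) :=
  ((\1 - P k) \o (A k \o (\1 - P k))^-1)%VF.

Lemma projC k v : P k (v - P k v) = 0.
Proof. by rewrite linearB/= P_proj subrr. Qed.

Lemma unstable_invK k w : P k.+1 w = 0 ->
  P k (unstable_inv k w) = 0 /\ A k (unstable_inv k w) = w.
Proof.
move=> Pw; rewrite /unstable_inv comp_lfunE/= add_lfunE opp_lfunE id_lfunE projC; split => //.
have [v Pv Av] := unstable_onto Pw.
have : w \in limg (A k \o (\1 - P k))%VF.
  apply/memv_imgP; exists v; first exact: memvf.
  by rewrite comp_lfunE/= add_lfunE opp_lfunE id_lfunE Pv subr0.
by move/limg_lfunVK; rewrite comp_lfunE/= add_lfunE opp_lfunE id_lfunE.
Qed.

Fixpoint stable_part (w : nat -> V) k : V :=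
  if k is k'.+1 then A k' (stable_part w k') + P k (w k') else 0.

(* [unstable_part N w j] is the value at time [N - j]: the unstable component
   is solved for backwards from time [N]. *)
Fixpoint unstable_part (N : nat) (w : nat -> V) j : V :=
  if j is j'.+1 then
    unstable_inv (N - j) (unstable_part N w j' - (w (N - j)%N - P (N - j') (w (N - j)%N)))
  else 0.

(** Discrete Green operator of [v k.+1 = A k (v k) + w k], with stable part 0 at time 0 and unstable
    part 0 at time [N]. These boundary conditions make its norm independent of [N]. *)
Definition green N w k : V := stable_part w k + unstable_part N w (N - k).

Lemma stable_partP w k : P k (stable_part w k) = stable_part w k.
Proof.
elim: k => [|k IH] /=; first by rewrite linear0.
by rewrite linearD/= P_proj (stable IH).1.
Qed.

Lemma unstable_partP N w j : (j <= N)%N -> P (N - j) (unstable_part N w j) = 0.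
Proof.
elim: j => [|j IH] jN /=; first by rewrite linear0.
have NS : (N - j = (N - j.+1).+1)%N by lia.
apply: (unstable_invK _).1; rewrite -NS linearB/= IH ?(ltnW jN)//.
by rewrite projC subrr.
Qed.

Lemma green_eq N w k : (k < N)%N ->
  green N w k.+1 = A k (green N w k) + w k.
Proof.
move=> kN; rewrite /green linearD/=.
have -> : (N - k = (N - k.+1).+1)%N by lia.
rewrite /=; have -> : (N - (N - k.+1).+1 = k)%N by lia.
have -> : (N - (N - k.+1) = k.+1)%N by lia.
rewrite (unstable_invK _).2.
  by rewrite opprB addrA -!addrA addNr addr0 [P k.+1 _ + _]addrC.
rewrite linearB/= projC.
by have := @unstable_partP N w (N - k.+1); rewrite subKn// => ->; rewrite ?subr0// leq_subr.
Qed.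

Lemma stable_partB w w' k :
  stable_part w k - stable_part w' k = stable_part (fun i => w i - w' i) k.
Proof.
elim: k => [|k IH] /=; first by rewrite subr0.
by rewrite -IH !linearB/= opprD addrACA.
Qed.

Lemma unstable_partB N w w' k :
  unstable_part N w k - unstable_part N w' k = unstable_part N (fun i => w i - w' i) k.
Proof.
elim: k => [|k IH] /=; first by rewrite subr0.
rewrite -IH -linearB/=; congr (unstable_inv _ _).
by rewrite !linearB/=; apply/rowP => i; rewrite !mxE; ring.
Qed.

(** A geometric series bounds each part by [C * (C + 1) * d / (1 - mu)] in [nu]. Another factor [C]
    returns to the norm, and 2 counts the parts. *)
Definition green_bound : R := 2 * C ^+ 2 * (C + 1) / (1 - mu).

Lemma green_bound_gt0 : 0 < green_bound.
Proof. by rewrite /green_bound divr_gt0 ?subr_gt0// !mulr_gt0// ?exprn_gt0// ltr_wpDr. Qed.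

Let bound_ge0 d : 0 <= d -> 0 <= C * (C + 1) * d / (1 - mu).
Proof.
by move=> d0; rewrite divr_ge0 ?subr_ge0 ?(ltW mu_lt1)// !mulr_ge0 ?addr_ge0 ?(ltW C_gt0).
Qed.

(** This makes the bound stable under one step of the recursion: contract by [mu], then add a
    forcing term. *)
Let boundE d : C * (C + 1) * d / (1 - mu) =
  mu * (C * (C + 1) * d / (1 - mu)) + C * (C + 1) * d.
Proof. by field; rewrite gt_eqF// subr_gt0. Qed.

Let nu0 k : nu k 0 <= 0.
Proof. by rewrite (le_trans (nu_le _ _))// normr0 mulr0. Qed.

Lemma stable_part_le N w d : 0 <= d -> (forall i, (i < N)%N -> `|w i| <= d) ->
  forall k, (k <= N)%N -> nu k (stable_part w k) <= C * (C + 1) * d / (1 - mu).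
Proof.
move=> d0 wd; elim=> [_|k IH kN] /=; first by rewrite (le_trans (nu0 _)) ?bound_ge0.
rewrite (le_trans (nu_triangle _ _ _))// boundE lerD//.
  by rewrite (le_trans (stable (stable_partP _ _)).2)// ler_wpM2l// IH// ltnW.
rewrite (le_trans (nu_le _ _))// -mulrA ler_wpM2l ?(ltW C_gt0)//.
rewrite (le_trans (P_le _ _))// mulrDl mul1r ler_wpDr// ler_wpM2l ?(ltW C_gt0)//.
exact: wd.
Qed.

Lemma unstable_part_le N w d : 0 <= d -> (forall i, (i < N)%N -> `|w i| <= d) ->
  forall j, (j <= N)%N -> nu (N - j) (unstable_part N w j) <= C * (C + 1) * d / (1 - mu).
Proof.
move=> d0 wd; elim=> [_|j IH jN] /=; first by rewrite (le_trans (nu0 _)) ?bound_ge0.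
have NS : (N - j = (N - j.+1).+1)%N by lia.
set y := _ - _; have Py : P (N - j.+1).+1 y = 0.
  by rewrite -NS /y linearB/= projC unstable_partP ?subr0// ltnW.
have [Pu Au] := unstable_invK Py.
rewrite (le_trans (unstable Pu).2)// Au -NS boundE.
have : nu (N - j)%N y <= C * (C + 1) * d / (1 - mu) + C * (C + 1) * d.
  rewrite (le_trans (nu_triangle _ _ _))// lerD// ?IH ?(ltnW jN)//.
  rewrite (le_trans (nu_le _ _))// -mulrA ler_wpM2l ?(ltW C_gt0)//.
  rewrite normrN (le_trans (ler_normB _ _))// [C + 1]addrC mulrDl mul1r lerD//.
    by apply: wd; lia.
  rewrite (le_trans (P_le _ _))// ler_wpM2l ?(ltW C_gt0)//.
  by apply: wd; lia.
move=> /(ler_wpM2l mu_ge0) /le_trans; apply; rewrite mulrDr lerD2l.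
by rewrite ler_piMl// ?(ltW mu_lt1)// !mulr_ge0 ?addr_ge0 ?(ltW C_gt0).
Qed.

Lemma green_le N w d : 0 <= d -> (forall i, (i < N)%N -> `|w i| <= d) ->
  forall k, (k <= N)%N -> `|green N w k| <= green_bound * d.
Proof.
move=> d0 wd k kN; rewrite (le_trans (ler_normD _ _))//.
have sk := stable_part_le d0 wd kN.
have := unstable_part_le d0 wd (leq_subr k N); rewrite subKn// => uk.
rewrite (le_trans (lerD (nu_ge k _) (nu_ge k _)))// -mulrDr.
rewrite (le_trans (ler_wpM2l (ltW C_gt0) (lerD sk uk)))//.
by rewrite /green_bound le_eqVlt; apply/orP; left; apply/eqP; ring.
Qed.

(** With [err = f - A], a fixed point of [T] satisfies [v k.+1 = A k (v k) + err v k = f k (v k)].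
    The smallness conditions make [T] contract by 1/2 and move 0 by at most [r / 2], so it preserves
    the closed ball of radius [r]. *)
Lemma finite_shadowing (f : nat -> V -> V) (r eta d : R) (N : nat) : 0 <= r -> 0 <= eta ->
  green_bound * eta <= 1 / 2 -> green_bound * d <= r / 2 ->
  (forall k u v, `|u| <= r -> `|v| <= r ->
     `|f k u - f k v - A k (u - v)| <= eta * `|u - v|) ->
  (forall k, `|f k 0| <= d) ->
  exists v : nat -> V, (forall k, (k <= N)%N -> `|v k| <= r) /\
    forall k, (k < N)%N -> f k (v k) = v k.+1.
Proof.
move=> r0 eta0 Keta Kd fA f0.
pose err (v : nat -> V) k := f k (v k) - A k (v k).
(* Sequences are stored as the rows of a matrix, whose norm is the largest norm of a row. *)
pose vals (x : 'M[R]_(N.+1, n)) k : V := row (inord k) x.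
pose T (x : 'M[R]_(N.+1, n)) : 'M[R]_(N.+1, n) :=
  \matrix_(i < N.+1) green N (err (vals x)) i.
have K0 := green_bound_gt0.
have vals_le x k : `|vals x k| <= `|x| by exact: ler_norm_row.
have d0 : 0 <= d by exact: le_trans (f0 0%N).
have errB x y k : `|x| <= r -> `|y| <= r ->
    `|err (vals x) k - err (vals y) k| <= eta * `|vals x k - vals y k|.
  move=> xr yr; apply: le_trans (fA k _ _ _ _); rewrite ?(le_trans (vals_le _ _))//.
  have subACA (a b c e : V) : a - b - (c - e) = a - c - (b - e).
    by rewrite !opprB !addrA [a - b + e]addrAC [a - c + e]addrAC addrAC.
  by rewrite /err (linearB (A k)) subACA.
have T_lip x y : `|x| <= r -> `|y| <= r -> `|T x - T y| <= 1 / 2 * `|x - y|.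
  move=> xr yr; apply: norm_rows_le => [|i]; first by rewrite mulr_ge0.
  rewrite linearB/= !rowK /green opprD addrACA stable_partB unstable_partB.
  apply: (@le_trans _ _ (green_bound * (eta * `|x - y|))); last first.
    by rewrite mulrA ler_wpM2r.
  apply: green_le => [|k kN|]; [by rewrite mulr_ge0| |by rewrite -ltnS].
  apply: le_trans (errB _ _ _ xr yr) _.
  by rewrite ler_wpM2l// /vals -linearB/= ler_norm_row.
have T0 : `|T 0| <= r / 2.
  apply: norm_rows_le => [|i]; first by rewrite divr_ge0.
  rewrite rowK (le_trans _ Kd)//; apply: green_le => [//|k _|]; last by rewrite -ltnS.
  by rewrite /err /vals linear0 linear0 subr0.
pose U := [set x : 'M[R]_(N.+1, n) | `|x| <= r].
have TU : {homo T : x / U x >-> U x}.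
  move=> x xr; rewrite /U/= -[T x](subrK (T 0)) (le_trans (ler_normD _ _))//.
  have := T_lip x 0 xr; rewrite normr0 subr0 => /(_ r0); move: xr T0; rewrite /U/=; lra.
have ctr : is_contraction (mkfun TU).
  exists (1 / 2)%:nng; split => /=; first by lra.
  by move=> [x y] [/= xr yr]; exact: T_lip.
have clU : closed U.
  by apply: preimage_closed (@closed_le R r) => x _; exact: norm_continuous.
have U0 : U !=set0 by exists 0; rewrite /U/= normr0.
have [x xr xT] := banach_fixed_point ctr clU U0.
exists (vals x); split => [k kN|k kN]; first exact: le_trans (vals_le _ _) xr.
have xE i : (i <= N)%N -> vals x i = green N (err (vals x)) i.
  by move=> iN; have := congr1 (row (inord i)) xT; rewrite /= rowK inordK.
by rewrite (xE k.+1)// green_eq// -xE 1?ltnW// /err addrC subrK.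
Qed.

End Shadowing.

(** * Tangent maps and Riemannian norms in charts *)

(** Compositions of charts simplify only near the base point, since charts have irrelevant values
    outside their domains. *)
Lemma near_eq_diff (R : realType) (V W : normedModType R) (f g : V -> W) a :
  differentiable f a -> differentiable g a -> (\near a, f a = g a) ->
  'd f a =1 'd g a.
Proof. by move=> df dg fg v; rewrite -!deriveE//; exact: near_eq_derive. Qed.

Lemma diff_idE (R : realType) (V : normedModType R) (x v : V) : 'd id x v = v.
Proof. by have /(congr1 (@^~ v)) := @diff_val _ _ _ _ _ _ _ (is_diff_id x). Qed.

Lemma differentiable_id (R : realType) (V : normedModType R) (x : V) :
  differentiable id x.
Proof. exact: (@ex_diff _ _ _ _ _ _ _ (is_diff_id x)). Qed.

Lemma diff_comp_at (R : realType) (U V W : normedModType R) (f : U -> V)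
    (g : V -> W) x y v : f x = y -> differentiable f x -> differentiable g y ->
  differentiable (g \o f) x /\ 'd (g \o f) x v = 'd g y ('d f x v).
Proof.
by move=> <- df dg; rewrite diff_comp//; split => //; exact: differentiable_comp.
Qed.

Section ChartCalculus.
Context (R : realType) (M : topologicalType) (n : nat).
Variable S : smooth_structure R M n.
Implicit Types (c : chart R M n) (x : M).

Lemma chart_inv_nearP c x (Q : set M) : chart_dom c x -> nbhs x Q ->
  \forall y \near c x, chart_cod c y /\ Q (chart_inv c y).
Proof.
move=> cx xQ; have ccx := chart_dom_cod cx.
near=> y; split; first by near: y; apply: open_nbhs_nbhs; split => //; exact: open_chart_cod.
by near: y; apply: (chart_inv_continuous ccx); rewrite chart_mapK.
Unshelve. all: by end_near. Qed.

Lemma chart_dom_nbhs c x : chart_dom c x -> nbhs x (chart_dom c).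
Proof. by move=> cx; apply: open_nbhs_nbhs; split => //; exact: open_chart_dom. Qed.

Lemma transition_differentiable c c' x : atlas S c -> atlas S c' ->
  chart_dom c x -> chart_dom c' x -> differentiable (c' \o chart_inv c) (c x).
Proof.
move=> Sc Sc' cx c'x; have [d _] := transition_smooth Sc Sc' 1%N.
by apply: d; exists x.
Qed.

Let Sat x := chart_at_atlas S x.
Let domat x := chart_at_dom S x.

Lemma tangent_coordE c x v : tangent_coord S c x v =
  'd (c \o chart_inv (chart_at S x)) (chart_at S x x) v.
Proof. by rewrite lfunE. Qed.

Lemma tangent_of_coordE c x v : tangent_of_coord S c x v =
  'd (chart_at S x \o chart_inv c) (c x) v.
Proof. by rewrite lfunE. Qed.

Lemma tangent_mapE f x v : tangent_map S f x v =
  'd (chart_at S (f x) \o f \o chart_inv (chart_at S x)) (chart_at S x x) v.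
Proof. by rewrite lfunE. Qed.

Lemma transition_diffK c c' x v : atlas S c -> atlas S c' ->
  chart_dom c x -> chart_dom c' x ->
  'd (c' \o chart_inv c) (c x) ('d (c \o chart_inv c') (c' x) v) = v.
Proof.
move=> Sc Sc' cx c'x.
have d1 := transition_differentiable Sc' Sc c'x cx.
have d2 : differentiable (c' \o chart_inv c) ((c \o chart_inv c') (c' x)).
  by rewrite /= (chart_mapK c'x); exact: transition_differentiable.
have := diff_comp d1 d2; rewrite /= (chart_mapK c'x) => /(congr1 (@^~ v)) /= <-.
transitivity ('d id (c' x) v); last exact: diff_idE.
apply: near_eq_diff.
- exact: differentiable_comp.
- exact: differentiable_id.
have := chart_inv_nearP c'x (chart_dom_nbhs cx).
by apply: filterS => y [ay cy] /=; rewrite chart_mapK// chart_invK.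
Qed.

Lemma tangent_coordK c x : atlas S c -> chart_dom c x ->
  cancel (tangent_coord S c x) (tangent_of_coord S c x).
Proof.
move=> Sc cx v; apply: (etrans (tangent_of_coordE _ _ _)).
apply: etrans (congr1 ('d _ _) (tangent_coordE _ _ _)) _.
exact: (transition_diffK _ Sc (Sat x) cx (domat x)).
Qed.

Lemma tangent_of_coordK c x : atlas S c -> chart_dom c x ->
  cancel (tangent_of_coord S c x) (tangent_coord S c x).
Proof.
move=> Sc cx v; apply: (etrans (tangent_coordE _ _ _)).
apply: etrans (congr1 ('d _ _) (tangent_of_coordE _ _ _)) _.
exact: (transition_diffK _ (Sat x) Sc (domat x) cx).
Qed.

Lemma diff2_differentiable (f : diff2 S) c c' x : atlas S c -> atlas S c' ->
  chart_dom c x -> chart_dom c' (f x) ->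
  differentiable (c' \o f \o chart_inv c) (c x).
Proof.
move=> Sc Sc' cx c'fx; have [_ /(_ c c' Sc Sc')[d _]] := diff2_map_C2 f.
by apply: d; exists x.
Qed.

Lemma diff2_continuous (f : diff2 S) : continuous f.
Proof. by have [] := diff2_map_C2 f. Qed.

(** Both sides differentiate the same germ, from the preferred chart at [x] to [c']: once through
    [c], once through the preferred chart at [f x]. *)
Lemma tangent_map_coord (f : diff2 S) c c' x v : atlas S c -> atlas S c' ->
  chart_dom c x -> chart_dom c' (f x) ->
  'd (c' \o f \o chart_inv c) (c x) (tangent_coord S c x v) =
  tangent_coord S c' (f x) (tangent_map S f x v).
Proof.
move=> Sc Sc' cx c'fx.
pose a := chart_at S x; pose b := chart_at S (f x).
apply: (etrans (congr1 ('d _ _) (tangent_coordE _ _ _))).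
apply: (etrans _ (esym (tangent_coordE _ _ _))).
apply: (etrans _ (congr1 ('d _ _) (esym (tangent_mapE _ _ _)))).
have d1 := transition_differentiable (Sat x) Sc (domat x) cx.
have d2 := diff2_differentiable Sc Sc' cx c'fx.
have d3 := diff2_differentiable (Sat x) (Sat (f x)) (domat x) (domat (f x)).
have d4 := transition_differentiable (Sat (f x)) Sc' (domat (f x)) c'fx.
have ac : (c \o chart_inv a) (a x) = c x by rewrite /= (chart_mapK (domat x)).
have ab : (b \o f \o chart_inv a) (a x) = b (f x).
  by rewrite /= (chart_mapK (domat x)).
have [d12 e12] := diff_comp_at v ac d1 d2.
have [d34 e34] := diff_comp_at v ab d3 d4.
apply: (etrans (esym e12)); apply: (etrans _ e34).
apply: (near_eq_diff d12 d34).
have fb : nbhs x (f @^-1` chart_dom b).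
  by apply: diff2_continuous; apply: chart_dom_nbhs; exact: domat.
have cfb : nbhs x (chart_dom c `&` f @^-1` chart_dom b).
  by apply: filterI fb; exact: chart_dom_nbhs.
have H := chart_inv_nearP (domat x) cfb.
by apply: filterS H => y [ay [cy by_]] /=; rewrite !chart_mapK.
Qed.

End ChartCalculus.

Lemma continuous_sum (R : realType) (T : topologicalType) (I : finType)
    (f : I -> T -> R) :
  (forall i, continuous (f i)) -> continuous (fun x => \sum_i f i x).
Proof.
move=> cf; rewrite (_ : (fun x => _) = \sum_i f i); last first.
  by apply/funext => x; rewrite fct_sumE.
elim/big_ind: _ => [x|f1 f2 c1 c2 x|i _]; [exact: cvg_cst| |exact: cf].
by apply: cvgD; [exact: c1|exact: c2].
Qed.

Lemma continuous_mul (R : realType) (T : topologicalType) (f h : T -> R) :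
  continuous f -> continuous h -> continuous (fun x => f x * h x).
Proof. by move=> cf ch x; apply: cvgM; [exact: cf|exact: ch]. Qed.

(** * The Riemannian norm read in a fixed chart *)

Section Gram.
Context (R : realType) (M : topologicalType) (n : nat).
Context (S : smooth_structure R M n) (g : riemannian_metric S).
Local Notation V := 'rV[R]_n.
Implicit Types (x : M) (u v w : V).

Definition inner x u v : R := (u *m gram g x *m v^T) 0 0.

Lemma innerDl x u v w : inner x (u + v) w = inner x u w + inner x v w.
Proof. by rewrite /inner !mulmxDl mxE. Qed.

Lemma innerZl x a u v : inner x (a *: u) v = a * inner x u v.
Proof. by rewrite /inner -!scalemxAl mxE. Qed.

Lemma innerC x u v : inner x u v = inner x v u.
Proof.
rewrite /inner -[in LHS](trmxK (u *m _ *m _)) mxE !trmx_mul trmxK gram_sym.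
by rewrite mulmxA.
Qed.

Lemma innerDr x u v w : inner x u (v + w) = inner x u v + inner x u w.
Proof. by rewrite innerC innerDl !(innerC x _ u). Qed.

Lemma innerZr x a u v : inner x u (a *: v) = a * inner x u v.
Proof. by rewrite innerC innerZl (innerC x v). Qed.

Lemma inner_ge0 x v : 0 <= inner x v v.
Proof.
have [->|/(gram_pos g x)/ltW//] := eqVneq v 0.
by rewrite /inner !mul0mx mxE.
Qed.

Lemma inner_cauchy_schwarz x u v : inner x u v ^+ 2 <= inner x u u * inner x v v.
Proof.
have [->|v0] := eqVneq v 0.
  by rewrite -(scale0r 0) innerZr mul0r expr0n/= mulr_ge0 ?inner_ge0.
have vv : 0 < inner x v v := gram_pos g x v0.
have := inner_ge0 x (inner x v v *: u + (- inner x u v) *: v).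
rewrite !(innerDl, innerDr, innerZl, innerZr) (innerC x v u) => H.
have : 0 <= inner x v v * (inner x u u * inner x v v - inner x u v ^+ 2).
  by apply: le_trans H _; rewrite le_eqVlt; apply/orP; left; apply/eqP; ring.
by rewrite pmulr_rge0// subr_ge0.
Qed.

Lemma tangent_norm_triangle x u v :
  tangent_norm g x (u + v) <= tangent_norm g x u + tangent_norm g x v.
Proof.
rewrite /tangent_norm -!/(inner x _ _).
rewrite -(ler_pXn2r (n := 2))// ?nnegrE ?addr_ge0 ?sqrtr_ge0//.
rewrite sqrrD !sqr_sqrtr ?inner_ge0// !(innerDl, innerDr) (innerC x v u).
suff : inner x u v <= Num.sqrt (inner x u u) * Num.sqrt (inner x v v) by lra.
rewrite -sqrtrM ?inner_ge0// (le_trans (ler_norm _))// -sqrtr_sqr ler_sqrt.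
  exact: inner_cauchy_schwarz.
by rewrite mulr_ge0 ?inner_ge0.
Qed.

Variable c : chart R M n.
Hypothesis Sc : atlas S c.

(** The preferred chart depends arbitrarily on [x], so continuity in [x] is only meaningful for
    coordinates in a fixed chart [c]. *)
Definition chart_inner x u v : R :=
  inner x (tangent_of_coord S c x u) (tangent_of_coord S c x v).

Definition chart_norm x v : R := tangent_norm g x (tangent_of_coord S c x v).

Lemma chart_normE x v : chart_norm x v = Num.sqrt (chart_inner x v v).
Proof. by []. Qed.

Lemma chart_norm_triangle x u v : chart_norm x (u + v) <= chart_norm x u + chart_norm x v.
Proof. by rewrite /chart_norm linearD tangent_norm_triangle. Qed.

Lemma chart_inner_sum x v : chart_inner x v v =
  \sum_i \sum_j v 0 i * v 0 j * chart_inner x (delta_mx 0 i) (delta_mx 0 j).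
Proof.
have suml (a : 'I_n -> R) (e : 'I_n -> V) w :
    chart_inner x (\sum_i a i *: e i) w = \sum_i a i * chart_inner x (e i) w.
  elim/big_rec2: _ => [|i y z _ <-].
    by rewrite /chart_inner linear0 /inner !mul0mx mxE.
  by rewrite /chart_inner linearD linearZ/= innerDl innerZl.
have C u w : chart_inner x u w = chart_inner x w u by exact: innerC.
rewrite [in LHS](row_sum_delta v) suml; apply: eq_bigr => i _.
rewrite C suml mulr_sumr; apply: eq_bigr => j _.
by rewrite mulrA (C _ (delta_mx 0 i)).
Qed.

Lemma chart_inner_continuous x u v : chart_dom c x ->
  {for x, continuous (fun y => chart_inner y u v)}.
Proof.
move=> cx.
have cF := gram_smooth g Sc u v 0%N _ (chart_dom_cod cx).
have := continuous_comp (chart_map_continuous cx) cF.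
rewrite /prop_for /continuous_at /= (chart_mapK cx).
apply: cvg_trans; apply: near_eq_cvg.
by apply: filterS (chart_dom_nbhs cx) => y cy /=; rewrite (chart_mapK cy).
Qed.

Lemma chart_inner_gt0 x v : chart_dom c x -> v != 0 -> 0 < chart_inner x v v.
Proof.
move=> cx v0; apply: gram_pos; apply: contra_neq v0 => /(congr1 (tangent_coord S c x)).
by rewrite (tangent_of_coordK Sc cx) linear0.
Qed.

Lemma chart_inner_near x e : chart_dom c x -> 0 < e ->
  \forall y \near x, forall v,
    `|chart_inner y v v - chart_inner x v v| <= e * `|v| ^+ 2.
Proof.
(* There are [n * n] entries; the successor keeps [k] positive in dimension 0. *)
move=> cx e0; pose k := (n * n).+1%:R : R; have k0 : 0 < k by rewrite ltr0n.
have H : \forall y \near x, forall ij : 'I_n * 'I_n,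
    `|chart_inner y (delta_mx 0 ij.1) (delta_mx 0 ij.2) -
      chart_inner x (delta_mx 0 ij.1) (delta_mx 0 ij.2)| <= e / k.
  apply: filter_forall => ij; have ek : 0 < e / k by rewrite divr_gt0.
  have /cvgrPdistC_le/(_ _ ek) := @chart_inner_continuous x (delta_mx 0 ij.1) (delta_mx 0 ij.2) cx.
  by apply: filterS => y.
apply: filterS H => y H v; rewrite !chart_inner_sum -sumrB.
under eq_bigr do rewrite -sumrB.
rewrite pair_big/= (le_trans (ler_norm_sum _ _ _))//.
apply: (@le_trans _ _ (\sum_(ij : 'I_n * 'I_n) (e / k * `|v| ^+ 2))).
  apply: ler_sum => ij _; rewrite -mulrBr normrM mulrC ler_pM// normrM expr2.
  by rewrite ler_pM// ler_mx_norm_coord.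
rewrite sumr_const card_prod card_ord -mulr_natl mulrA ler_wpM2r ?exprn_ge0//.
by rewrite mulrCA ler_piMr ?(ltW e0)// ler_pdivrMr// mul1r ler_nat.
Qed.

(** [a] is the minimum of the quadratic form on the unit sphere, and homogeneity does the rest. An
    empty sphere means that every vector is 0. *)
Lemma chart_inner_lower x : chart_dom c x ->
  exists2 a, 0 < a & forall v, a * `|v| ^+ 2 <= chart_inner x v v.
Proof.
move=> cx; pose A := [set v : V | `|v| = 1].
have normA v : v != 0 -> A (`|v|^-1 *: v).
  by move=> v0; rewrite /A/= normrZ normfV normr_id mulVf ?normr_eq0.
have [A0|] := pselect (A !=set0); last first.
  move=> /nonemptyPn A0; exists 1 => // v; have [->|/normA] := eqVneq v 0.
    by rewrite normr0 expr0n mulr0; exact: inner_ge0.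
  by rewrite A0.
have cA : compact A.
  apply: bounded_closed_compact.
    exists 1; split => // t t1 v; rewrite /A/= => ->; exact: ltW.
  by apply: preimage_closed (@closed_eq R 1) => v _; exact: norm_continuous.
have cq : continuous (fun v => chart_inner x v v).
  rewrite (funext (chart_inner_sum x)).
  apply: continuous_sum => i; apply: continuous_sum => j.
  apply: (@continuous_mul _ V (fun v => v 0 i * v 0 j)); last by apply: cst_continuous.
  by apply: continuous_mul => ?; exact: coord_continuous.
have [v vA vmin] := EVT_min_rV A0 cA (continuous_subspaceT cq).
have v0 : v != 0.
  by apply: contra_eq_neq (set_mem vA) => ->; rewrite normr0 eq_sym oner_neq0.
exists (chart_inner x v v); first exact: chart_inner_gt0.
move=> w; have [->|w0] := eqVneq w 0.
  by rewrite normr0 expr0n mulr0; exact: inner_ge0.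
have := vmin (`|w|^-1 *: w) (mem_set (normA _ w0)).
rewrite [leRHS]/chart_inner linearZ innerZl innerZr -/(chart_inner x w w) mulrA -expr2.
by rewrite exprVn mulrC -ler_pdivrMr ?invr_gt0 ?exprn_gt0 ?normr_gt0// invrK.
Qed.

Let sqrt_le (e a b : R) : 0 <= e -> b <= (1 + e) * a -> Num.sqrt b <= (1 + e) * Num.sqrt a.
Proof.
move=> e0 ba; have [a0|a0] := leP 0 a; last first.
  rewrite !ler0_sqrtr ?mulr0//; first exact: ltW.
  by rewrite (le_trans ba)// mulr_ge0_le0 ?addr_ge0// ltW.
rewrite -[X in X * Num.sqrt a](ger0_norm (x := 1 + e)) ?addr_ge0// -sqrtr_sqr.
rewrite -sqrtrM ?sqr_ge0// ler_wsqrtr// (le_trans ba)// ler_wpM2r//.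
by rewrite expr2 ler_peMr ?addr_ge0// lerDl.
Qed.

Lemma chart_norm_near x e : chart_dom c x -> 0 < e ->
  \forall y \near x, forall v, chart_norm y v <= (1 + e) * chart_norm x v /\
                               chart_norm x v <= (1 + e) * chart_norm y v.
Proof.
move=> cx e0; have [a a0 alow] := chart_inner_lower cx.
(* Chosen so that [(1 + e) * (1 - t) = 1]: a relative error [t] on the quadratic form then gives
   both inequalities. *)
pose t := e / (1 + e); have e1 : 0 < 1 + e by rewrite addr_gt0.
have t0 : 0 < t by rewrite divr_gt0.
have te : t * (1 + e) = e by rewrite /t divfK ?gt_eqF.
have at0 : 0 < a * t by rewrite mulr_gt0.
apply: filterS (chart_inner_near cx at0) => y yx v.
have := yx v; have := alow v; rewrite !chart_normE.
have : 0 <= chart_inner x v v by exact: inner_ge0.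
move: (chart_inner x v v) (chart_inner y v v) (`|v| ^+ 2) => qx qy N qx0.
move=> aN; rewrite ler_norml => /andP[lo up].
have tN : a * t * N <= t * qx by rewrite mulrAC mulrC ler_wpM2l ?(ltW t0).
split; apply: sqrt_le; rewrite ?(ltW e0)//.
  have : t * qx <= e * qx by rewrite ler_wpM2r// -te ler_peMr ?(ltW t0)// lerDl ltW.
  by move: up tN; lra.
have H : (1 - t) * qx <= qy by move: lo tN; lra.
have -> : qx = (1 + e) * ((1 - t) * qx) by rewrite mulrA mulrBr mulr1 [_ * t]mulrC te addrK mul1r.
by rewrite ler_wpM2l// ltW.
Qed.

Lemma chart_norm_bound x : chart_dom c x ->
  exists2 C, 0 < C & \forall y \near x, forall v,
     `|v| <= C * chart_norm y v /\ chart_norm y v <= C * `|v|.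
Proof.
move=> cx; have [a a0 alow] := chart_inner_lower cx.
pose K := \sum_i \sum_j `|chart_inner x (delta_mx 0 i) (delta_mx 0 j)|.
have K0 : 0 <= K by apply: sumr_ge0 => i _; exact: sumr_ge0.
have upK v : chart_inner x v v <= K * `|v| ^+ 2.
  rewrite chart_inner_sum mulr_suml; apply: ler_sum => i _.
  rewrite mulr_suml; apply: ler_sum => j _; rewrite (le_trans (ler_norm _))//.
  rewrite normrM mulrC ler_wpM2l// normrM expr2.
  by rewrite ler_pM// ler_mx_norm_coord.
(* The two roots compare the norm at [x] with the sup norm, and 2 is the factor [1 + e] of
   [chart_norm_near] for [e = 1]. *)
pose C := 2 * (Num.sqrt a^-1 + Num.sqrt K + 1).
exists C; first by rewrite mulr_gt0// ltr_wpDl ?addr_ge0 ?sqrtr_ge0.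
apply: filterS (chart_norm_near cx ltr01) => y yx v.
have [yv xv] := yx v.
have vx : `|v| <= Num.sqrt a^-1 * chart_norm x v.
  rewrite chart_normE -sqrtrM ?invr_ge0 ?(ltW a0)// -[leLHS]ger0_norm// -sqrtr_sqr.
  by rewrite ler_wsqrtr// -ler_pdivrMl ?invr_gt0// invrK.
have xv' : chart_norm x v <= Num.sqrt K * `|v|.
  rewrite chart_normE -[X in _ * X]ger0_norm// -sqrtr_sqr -sqrtrM//.
  by rewrite ler_wsqrtr.
have nx : 0 <= chart_norm x v by exact: sqrtr_ge0.
have ny : 0 <= chart_norm y v by exact: sqrtr_ge0.
have nv : 0 <= `|v| by [].
move: yv xv vx xv' nx ny nv; rewrite /C.
move: (chart_norm x v) (chart_norm y v) (`|v|) (Num.sqrt a^-1) (Num.sqrt K)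
  (sqrtr_ge0 a^-1) (sqrtr_ge0 K) => nx ny nv A B A0 B0 yv xv vx xv' nx0 ny0 nv0.
split.
  apply: (le_trans vx); apply: (le_trans (ler_wpM2l A0 xv)).
  by rewrite mulrA; apply: ler_wpM2r => //; lra.
apply: (le_trans yv); apply: (@le_trans _ _ ((1 + 1) * (B * nv))).
  by rewrite ler_wpM2l.
by rewrite mulrA; apply: ler_wpM2r => //; lra.
Qed.

End Gram.

Lemma linear_norm_le (R : realType) n (W : normedModType R)
    (f : {linear 'rV[R]_n -> W}) v :
  `|f v| <= (\sum_i `|f (delta_mx 0 i)|) * `|v|.
Proof.
rewrite [in leLHS](row_sum_delta v) linear_sum mulr_suml.
rewrite (le_trans (ler_norm_sum _ _ _))//; apply: ler_sum => i _.
by rewrite linearZ/= normrZ mulrC ler_wpM2l// ler_mx_norm_coord.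
Qed.

(** * Continuity of the projection defined by a splitting *)

Section Projection.
Context (R : realType) (n : nat).
Local Notation V := 'rV[R]_n.
Implicit Types E G : {vspace V}.

Lemma daddv_piP E G v : (E :&: G = 0)%VS -> (E + G = fullv)%VS ->
  daddv_pi E G v \in E /\ v - daddv_pi E G v \in G.
Proof.
move=> EG0 EGT; split; first exact: memv_pi.
have := daddv_pi_add EG0 (w := v); rewrite EGT memvf => /(_ isT) H.
by rewrite -[X in X - _]H addrAC subrr add0r memv_pi.
Qed.

Lemma daddv_pi_uniq E G v w : (E :&: G = 0)%VS -> v \in E -> w \in G ->
  daddv_pi E G (v + w) = v.
Proof.
move=> EG0 vE wG; rewrite linearD/= daddv_pi_id//.
have GE0 : (G :&: E = 0)%VS by rewrite capvC.
have wEG : w \in (E + G)%VS by rewrite -[w]add0r memv_add// mem0v.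
have := daddv_pi_add EG0 wEG; rewrite (daddv_pi_id GE0 wG) => /(canRL (addrK _)).
by rewrite subrr => ->; rewrite addr0.
Qed.

(** Expand [w] in the frames at [p] and let [v = v1 + v2] have the same coefficients in the frames
    at [p0]. Then [v1 = P0 v] is close to [Pp w], and [v] is close to [w]. *)
Lemma daddv_pi_near (T : topologicalType) (p0 : T) (E G : T -> {vspace V}) k l
    (e : 'I_k -> T -> V) (h : 'I_l -> T -> V) (d : R) : 0 < d ->
  (forall i, {for p0, continuous (e i)}) -> (forall j, {for p0, continuous (h j)}) ->
  (\forall p \near p0, [/\ basis_of (E p) [tuple e i p | i < k],
     basis_of (G p) [tuple h j p | j < l], (E p :&: G p = 0)%VS &
     (E p + G p = fullv)%VS]) ->
  \forall p \near p0, forall v,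
    `|daddv_pi (E p) (G p) v - daddv_pi (E p0) (G p0) v| <= d * `|v|.
Proof.
move=> d0 ce ch near_basis.
have [bE0 bG0 EG0 EGT0] := nbhs_singleton near_basis.
pose P0 := daddv_pi (E p0) (G p0).
pose X0 := [tuple e i p0 | i < k]; pose Y0 := [tuple h j p0 | j < l].
pose C0 : R := \sum_i `|P0 (delta_mx 0 i)|.
have C00 : 0 <= C0 by apply: sumr_ge0.
have P0_le v : `|P0 v| <= C0 * `|v| by exact: linear_norm_le.
have Q0_le v : `|v - P0 v| <= (1 + C0) * `|v|.
  by rewrite mulrDl mul1r (le_trans (ler_normB _ _))// lerD.
pose K1 : R := \sum_i \sum_j `|coord X0 i (delta_mx 0 j)|.
pose K2 : R := \sum_i \sum_j `|coord Y0 i (delta_mx 0 j)|.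
have K10 : 0 <= K1 by apply: sumr_ge0 => i _; exact: sumr_ge0.
have K20 : 0 <= K2 by apply: sumr_ge0 => i _; exact: sumr_ge0.
have X0_le i v : `|coord X0 i v| <= K1 * `|v|.
  rewrite (le_trans (linear_norm_le (coord X0 i : {linear _ -> R^o}) v))//.
  rewrite ler_wpM2r// /K1 (bigD1 i)//= lerDl; apply: sumr_ge0 => j _.
  exact: sumr_ge0.
have Y0_le i v : `|coord Y0 i v| <= K2 * `|v|.
  rewrite (le_trans (linear_norm_le (coord Y0 i : {linear _ -> R^o}) v))//.
  rewrite ler_wpM2r// /K2 (bigD1 i)//= lerDl; apply: sumr_ge0 => j _.
  exact: sumr_ge0.
pose K : R := (K1 + K2) * (1 + C0); pose s : R := (k + l)%:R * K.
have K0 : 0 <= K by rewrite mulr_ge0 ?addr_ge0.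
have s0 : 0 <= s by rewrite mulr_ge0.
have C01 : 0 < 1 + C0 by lra.
have s1 : 0 < s + 1 by lra.
have den0 : 0 < 2 * (s + 1) * (1 + C0) by rewrite !mulr_gt0.
(* The minimum with 1 gives [s * t <= 1 / 2], hence [|v| <= 2 * |w|]; the minimum with [d] gives the
   final estimate. *)
pose t : R := Num.min 1 d / (2 * (s + 1) * (1 + C0)).
have t0 : 0 < t by rewrite divr_gt0 ?lt_min ?ltr01.
have tE : t * (2 * (s + 1) * (1 + C0)) = Num.min 1 d by rewrite divfK// gt_eqF.
have min1 : Num.min 1 d <= 1 by rewrite ge_min lexx.
have mind : Num.min 1 d <= d by rewrite ge_min lexx orbT.
have near_e : \forall p \near p0, forall i, `|e i p - e i p0| <= t.
  apply: filter_forall => i; have /cvgrPdistC_le/(_ _ t0) := ce i.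
  by apply: filterS => p.
have near_h : \forall p \near p0, forall i, `|h i p - h i p0| <= t.
  apply: filter_forall => i; have /cvgrPdistC_le/(_ _ t0) := ch i.
  by apply: filterS => p.
apply: filterS3 near_basis near_e near_h => p [bE bG EGp EGTp] ep hp w.
pose Pp := daddv_pi (E p) (G p).
pose a i : R := coord [tuple e i p | i < k] i (Pp w).
pose b j : R := coord [tuple h j p | j < l] j (w - Pp w).
have [PwE QwG] := daddv_piP w EGp EGTp.
have PpE : Pp w = \sum_i a i *: e i p.
  rewrite {1}(coord_basis bE PwE); apply: eq_bigr => i _.
  by rewrite (nth_map i) ?size_enum_ord// nth_ord_enum.
have QpE : w - Pp w = \sum_j b j *: h j p.
  rewrite {1}(coord_basis bG QwG); apply: eq_bigr => i _.
  by rewrite (nth_map i) ?size_enum_ord// nth_ord_enum.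
pose v1 : V := \sum_i a i *: e i p0; pose v2 : V := \sum_j b j *: h j p0.
have X0i (i : 'I_k) : X0`_i = e i p0 by rewrite (nth_map i) ?size_enum_ord// nth_ord_enum.
have Y0i (i : 'I_l) : Y0`_i = h i p0 by rewrite (nth_map i) ?size_enum_ord// nth_ord_enum.
have v1X : v1 = \sum_i a i *: X0`_i by apply: eq_bigr => i _; rewrite X0i.
have v2Y : v2 = \sum_i b i *: Y0`_i by apply: eq_bigr => i _; rewrite Y0i.
have v1E : v1 \in E p0.
  by apply: memv_suml => i _; rewrite memvZ// -X0i (basis_mem bE0)// mem_nth// size_tuple.
have v2G : v2 \in G p0.
  by apply: memv_suml => i _; rewrite memvZ// -Y0i (basis_mem bG0)// mem_nth// size_tuple.
have P0v : P0 (v1 + v2) = v1 by exact: daddv_pi_uniq.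
pose v := v1 + v2.
(* The coefficients are also coordinates of [v] in the fixed frames at [p0], so no bound on the
   moving frames is needed. *)
have aK i : `|a i| <= K * `|v|.
  have -> : a i = coord X0 i (P0 v).
    by rewrite P0v v1X coord_sum_free// (basis_free bE0).
  rewrite (le_trans (X0_le _ _))// /K -mulrA ler_pM//; first by rewrite lerDl.
  by rewrite (le_trans (P0_le _))// ler_wpM2r// lerDr.
have bK i : `|b i| <= K * `|v|.
  have -> : b i = coord Y0 i (v - P0 v).
    by rewrite P0v /v addrAC subrr add0r v2Y coord_sum_free// (basis_free bG0).
  by rewrite (le_trans (Y0_le _ _))// /K -mulrA ler_pM// lerDr.
have PpB : `|Pp w - v1| <= k%:R * (K * `|v| * t).
  rewrite PpE -sumrB (le_trans (ler_norm_sum _ _ _))//.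
  rewrite -[X in X%:R * _](card_ord k) mulr_natl -sumr_const; apply: ler_sum => i _.
  by rewrite -scalerBr normrZ ler_pM.
have QpB : `|w - Pp w - v2| <= l%:R * (K * `|v| * t).
  rewrite QpE -sumrB (le_trans (ler_norm_sum _ _ _))//.
  rewrite -[X in X%:R * _](card_ord l) mulr_natl -sumr_const; apply: ler_sum => i _.
  by rewrite -scalerBr normrZ ler_pM.
have wvB : `|w - v| <= s * t * `|v|.
  have -> : w - v = (Pp w - v1) + (w - Pp w - v2).
    by rewrite addrACA [Pp w + _]addrC subrK -opprD.
  rewrite (le_trans (ler_normD _ _))// (le_trans (lerD PpB QpB))//.
  by rewrite -mulrDl -natrD /s le_eqVlt; apply/orP; left; apply/eqP; ring.
have st : s * t * (2 * (1 + C0)) <= Num.min 1 d.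
  rewrite -tE; have : 0 <= t * (2 * (1 + C0)).
    by apply: mulr_ge0; [exact: ltW|apply: mulr_ge0 => //; exact: ltW].
  lra.
have st0 : 0 <= s * t by rewrite mulr_ge0// (ltW t0).
have st2 : s * t * 2 <= 1.
  rewrite (le_trans _ min1)// (le_trans _ st)// mulrA ler_peMr ?lerDl//.
  by rewrite mulr_ge0.
have v2w : `|v| <= 2 * `|w|.
  have : `|v| <= `|w| + `|w - v|.
    by rewrite -[X in `|X|](subKr w) (le_trans (ler_normB _ _))//.
  have : s * t * `|v| <= 1 / 2 * `|v| by rewrite ler_wpM2r//; lra.
  lra.
have kl : k%:R * (K * `|v| * t) <= s * t * `|v|.
  have : k%:R * (K * `|v| * t) <= (k + l)%:R * (K * `|v| * t).
    apply: ler_wpM2r; last by rewrite ler_nat leq_addr.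
    by apply: mulr_ge0; [exact: mulr_ge0|exact: ltW].
  by move=> /le_trans; apply; rewrite /s le_eqVlt; apply/orP; left; apply/eqP; ring.
have -> : daddv_pi (E p) (G p) w - daddv_pi (E p0) (G p0) w =
    (Pp w - v1) + - P0 (w - v).
  by rewrite linearB/= P0v opprB addrA subrK.
rewrite (le_trans (ler_normD _ _))// normrN.
rewrite (le_trans (lerD (le_trans PpB kl) (le_trans (P0_le _) (ler_wpM2l C00 wvB))))//.
rewrite -[X in X + _]mul1r -mulrDl.
rewrite (le_trans (ler_wpM2l _ (ler_wpM2l st0 v2w))) ?addr_ge0//.
have -> : (1 + C0) * (s * t * (2 * `|w|)) = s * t * (2 * (1 + C0)) * `|w| by ring.
by rewrite ler_wpM2r// (le_trans st).
Qed.

End Projection.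

(** The norm is a maximum of coordinates, so the mean value theorem on a segment is applied to each
    one, with its own intermediate point. The factor [n] counts the partial derivatives. *)
Lemma mean_value_le (R : realType) (n m : nat) (f : 'rV[R]_n -> 'rV[R]_m)
    (y0 : 'rV[R]_n) (r eta : R) :
  (forall u, `|u| <= r -> differentiable f (y0 + u) /\
     forall i, `|'d f (y0 + u) (delta_mx 0 i) - 'd f y0 (delta_mx 0 i)| <= eta) ->
  forall u v, `|u| <= r -> `|v| <= r ->
    `|f (y0 + u) - f (y0 + v) - 'd f y0 (u - v)| <= n%:R * eta * `|u - v|.
Proof.
move=> Hf u v ur vr.
have segr t : 0 <= t -> t <= 1 -> `|v + t *: (u - v)| <= r.
  move=> t0 t1; have -> : v + t *: (u - v) = (1 - t) *: v + t *: u.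
    by apply/rowP => i; rewrite !mxE; ring.
  rewrite (le_trans (ler_normD _ _))// !normrZ (ger0_norm t0) ger0_norm ?subr_ge0//.
  have : (1 - t) * `|v| <= (1 - t) * r by rewrite ler_wpM2l// subr_ge0.
  have : t * `|u| <= t * r by rewrite ler_wpM2l.
  lra.
have r0 : 0 <= r by rewrite (le_trans _ ur).
apply: mx_norm_leP => [|i j]; rewrite ?(ord1 i).
  rewrite mulr_ge0// ; case: n f y0 Hf u v ur vr segr => [|n] f y0 Hf *; first by rewrite mul0r.
  have [|_ /(_ ord0)] := Hf 0; first by rewrite normr0.
  by move=> /(le_trans (normr_ge0 _)) eta0; rewrite mulr_ge0.
pose w := u - v; pose L : R := 'd f y0 w 0 j.
pose gam : R -> 'rV[R]_n := cst (y0 + v) + ( *:%R ^~ w).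
have gamE t : gam t = y0 + (v + t *: w) by rewrite addrA.
pose h := fun t => f (gam t) 0 j - t * L.
have dh (t : R) : 0 <= t -> t <= 1 ->
    is_derive t (1 : R) h (('d f (gam t) w) 0 j - L).
  move=> t0 t1.
  have [dft _] := Hf _ (segr t t0 t1).
  have dgam : is_diff t gam (0 + ( *:%R ^~ w)) by exact: is_diffD.
  have [dfg fgE] := diff_comp_at (1 : R) (gamE t) (@ex_diff _ _ _ _ _ _ _ dgam) dft.
  have der := diff_derivable (v := (1 : R)) dfg.
  have derj : is_derive t (1 : R) (fun t => f (gam t) 0 j) (('d f (gam t) w) 0 j).
    apply: DeriveDef; first exact: (derivable_mxP _ _ _).1.
    have := derive_mx der; rewrite deriveE// fgE (@diff_val _ _ _ _ _ _ _ dgam).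
    move=> /matrixP/(_ 0 j); rewrite !mxE => <-.
    by rewrite gamE /= add0r scale1r.
  have derL : is_derive t (1 : R) (fun t => t * L) L.
    have H := is_deriveM (is_derive_id t (1 : R)) (is_derive_cst L t (1 : R)).
    by apply: (is_derive_eq H); rewrite scaler0 add0r; exact: mulr1.
  exact: (is_deriveB derj derL).
have hc : {within `[0, 1], continuous h}.
  apply: continuous_in_subspaceT => t; rewrite inE/= in_itv/= => /andP[t0 t1].
  have := dh t t0 t1 => -[dht _].
  exact/differentiable_continuous/derivable1_diffP.
have [|c] := MVT (ltr01 : 0 < 1 :> R) _ hc (df := fun t => ('d f (gam t) w) 0 j - L).
  by move=> t; rewrite in_itv/= => /andP[t0 t1]; apply: dh; exact: ltW.
rewrite in_itv/= => /andP[c0 c1]; rewrite subr0 mulr1 /h mul1r mul0r subr0.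
rewrite !gamE scale1r scale0r addr0 subrKC => E.
rewrite !mxE -/w -/L -[X in `|X|](_ : f (y0 + u) 0 j - L - f (y0 + v) 0 j = _); last by ring.
rewrite E /L.
have [_ Hc] := Hf _ (segr c (ltW c0) (ltW c1)).
have -> : ('d f (y0 + (v + c *: w))) w 0 j - ('d f y0) w 0 j =
    ('d f (y0 + (v + c *: w)) w - 'd f y0 w) 0 j by rewrite !mxE.
rewrite (le_trans (ler_mx_norm_coord _ _ _))//.
rewrite (le_trans (linear_norm_le ('d f (y0 + (v + c *: w)) \- 'd f y0) w))//.
rewrite ler_wpM2r// -[X in X%:R * _](card_ord n) mulr_natl -sumr_const.
by apply: ler_sum => k _; exact: Hc.
Qed.

Lemma continuous_nbhs (T U : topologicalType) (f : T -> U) x (N : set U) :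
  continuous f -> nbhs (f x) N -> nbhs x (f @^-1` N).
Proof. by move=> cf; exact: cf. Qed.

Lemma near_forall (T : topologicalType) (I : finType) (x : T) (P : I -> T -> Prop) :
  (forall i, \forall y \near x, P i y) -> \forall y \near x, forall i, P i y.
Proof. exact: filter_forall. Qed.

Lemma nbhs_le_norm (R : realType) n (y : 'rV[R]_n) (B : set 'rV[R]_n) :
  nbhs y B -> exists2 r, 0 < r & forall z, `|z - y| <= r -> B z.
Proof.
move=> nB; have [r /= r0 rB] : nbhs_ball y B by rewrite nbhs_ballE.
exists (r / 2) => [|z zr]; first by rewrite divr_gt0.
apply: rB; rewrite -ball_normE /= distrC (le_lt_trans zr)//.
by rewrite ltr_pdivrMr// ltr_pMr// ltr1n.
Qed.

(** * Regularity of the fiber maps jointly in the base and fiber variables *)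

Section JointContinuity.
Context (R : realType) (M : metricType R) (n : nat) (S : smooth_structure R M n).
Context (Omega : topologicalType) (F : Omega -> diff2 S).
Hypothesis M_compact : compact [set: M].
Hypothesis F_continuous : continuous F.

Lemma open_C2_subbasic f c c' K e : @C2_subbase R M n S (C2_subbasic f c c' K e) ->
  open (C2_subbasic f c c' K e).
Proof.
move=> H; exists [set C2_subbasic f c c' K e]; last by rewrite bigcup_set1.
by move=> _ ->; exact: (@finI_from1 _ _ _ id).
Qed.

Lemma compact_nbhs (x : M) (U : set M) : nbhs x U ->
  exists K : set M, [/\ compact K, nbhs x K & K `<=` U].
Proof.
move=> xU; have [r /= r0 rU] : nbhs_ball x U by rewrite nbhs_ballE.
exists (closure (ball x (r / 2))); split.
- by apply: subclosed_compact M_compact _ => //; exact: closed_closure.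
- have : nbhs x (ball x (r / 2)) by apply: nbhsx_ballx; rewrite divr_gt0.
  exact: (filterS (@subset_closure _ _)).
- move=> y /(_ (ball y (r / 2)))[]; first by apply: nbhsx_ballx; rewrite divr_gt0.
  move=> z [xz yz]; apply: rU; rewrite [r]splitr.
  exact: ball_triangle xz (ball_sym yz).
Qed.

Let local w c c' := (c' \o F w \o chart_inv c : 'rV[R]_n -> 'rV[R]_n).

(** One half of [e] is for changing the fiber, by the C^2 topology over a compact neighbourhood [K];
    the other is for moving the point, by the regularity of [F w0] alone. *)
Lemma fiber_joint_continuity w0 x0 c c' e : atlas S c -> atlas S c' ->
  chart_dom c x0 -> chart_dom c' (F w0 x0) -> 0 < e ->
  \forall z \near (w0, c x0), [/\ chart_cod c z.2,
     chart_dom c' (F z.1 (chart_inv c z.2)),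
     `|local z.1 c c' z.2 - local w0 c c' (c x0)| <= e &
     forall i, `|'d (local z.1 c c') (z.2) (delta_mx 0 i) -
                 'd (local w0 c c') (c x0) (delta_mx 0 i)| <= e].
Proof.
move=> Sc Sc' cx c'x e0.
have U0 : nbhs x0 (chart_dom c `&` F w0 @^-1` chart_dom c').
  by apply: filterI; [|apply: diff2_continuous]; exact: chart_dom_nbhs.
have [K [Kc xK KU]] := compact_nbhs U0.
have e2 : 0 < e / 2 by rewrite divr_gt0.
have nearw : nbhs w0 (F @^-1` C2_subbasic (F w0) c c' K (e / 2)).
  have oN : open (C2_subbasic (F w0) c c' K (e / 2)).
    apply: open_C2_subbasic; exists (F w0), c, c', K, (e / 2); split => //.
    by split=> [y /KU[]//|_ [y /KU[_ ?] <-]].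
  have FN : C2_subbasic (F w0) c c' K (e / 2) (F w0).
    split=> [_ [y /KU[_ ?] <-]//|].
    by split=> [y _|i]; [|split=> [y _|j]; [|split=> // y _]]; rewrite subrr normr0.
  have nN : nbhs (F w0) (C2_subbasic (F w0) c c' K (e / 2)).
    exact: open_nbhs_nbhs.
  exact: (continuous_nbhs F_continuous nN).
have [_ /(_ c c' Sc Sc')[dF dF2]] := diff2_map_C2 (F w0).
pose U := c @` (chart_dom c `&` F w0 @^-1` chart_dom c').
have Ux : U (c x0) by exists x0.
have cF : {for c x0, continuous (local w0 c c')}.
  by apply: differentiable_continuous; exact: dF.
have cdF i : {for c x0, continuous (fun y => 'd (local w0 c c') y (delta_mx 0 i))}.
  apply: differentiable_continuous; have [+ _] := dF2 (delta_mx 0 i).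
  by apply.
have neary : \forall y \near c x0, [/\ chart_cod c y, K (chart_inv c y),
     `|local w0 c c' y - local w0 c c' (c x0)| <= e / 2 &
     forall i, `|'d (local w0 c c') y (delta_mx 0 i) -
                 'd (local w0 c c') (c x0) (delta_mx 0 i)| <= e / 2].
  have H1 := chart_inv_nearP cx xK.
  have /cvgrPdistC_le/(_ _ e2) H2 := cF.
  have H3 : \forall y \near c x0, forall i, `|'d (local w0 c c') y (delta_mx 0 i) -
                 'd (local w0 c c') (c x0) (delta_mx 0 i)| <= e / 2.
    apply: near_forall => i.
    by have /cvgrPdistC_le/(_ _ e2) := cdF i.
  by apply: filterS3 H1 H2 H3 => y [].
exists (F @^-1` C2_subbasic (F w0) c c' K (e / 2),
  [set y | [/\ chart_cod c y, K (chart_inv c y),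
     `|local w0 c c' y - local w0 c c' (c x0)| <= e / 2 &
     forall i, `|'d (local w0 c c') y (delta_mx 0 i) -
                 'd (local w0 c c') (c x0) (delta_mx 0 i)| <= e / 2]]) => //.
move=> [w y] /= [[FK [clF clD]] [cy Ky y0 y1]].
have cKy : (c @` K) y by exists (chart_inv c y) => //; exact: chart_invK.
split.
- exact: cy.
- by apply: FK; exists (chart_inv c y).
- rewrite [e]splitr -(subrKA (local w0 c c' y)) (le_trans (ler_normD _ _))// lerD//.
  by rewrite distrC ltW//; exact: clF.
move=> i; rewrite [e]splitr -(subrKA ('d (local w0 c c') y (delta_mx 0 i))).
apply: (le_trans (ler_normD _ _)); apply: lerD; last exact: y1.
have [D _] := clD i; rewrite distrC.
apply: ltW; exact: (D y cKy).
Qed.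

Lemma fiber_map_continuous : continuous (fun p : Omega * M => F p.1 p.2).
Proof.
move=> [w0 x0] U /= nU; pose c := chart_at S x0; pose c' := chart_at S (F w0 x0).
have cx : chart_dom c x0 by exact: chart_at_dom.
have c'x : chart_dom c' (F w0 x0) by exact: chart_at_dom.
have [e e0 eU] := nbhs_le_norm (chart_inv_nearP c'x nU).
have [[A B] [/= nA nB] AB] := fiber_joint_continuity (chart_at_atlas S x0)
  (chart_at_atlas S (F w0 x0)) cx c'x e0.
exists (A, chart_dom c `&` c @^-1` B).
  split=> //=; apply: filterI; first exact: chart_dom_nbhs.
  exact: (chart_map_continuous cx nB).
move=> [w x] /= [Aw [dx Bx]]; have [] := AB (w, c x) (conj Aw Bx).
rewrite /local/= !chart_mapK// => _ c'w we _.
by have [_] := eU _ we; rewrite chart_mapK.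
Qed.

Lemma fiber_local_uniform w0 x0 c c' eta : atlas S c -> atlas S c' ->
  chart_dom c x0 -> chart_dom c' (F w0 x0) -> 0 < eta ->
  exists2 rho, 0 < rho & \forall p \near (w0, x0), forall v, `|v| <= rho ->
    [/\ chart_cod c (c p.2 + v), chart_dom c' (F p.1 (chart_inv c (c p.2 + v))) &
     forall i, `|'d (local p.1 c c') (c p.2 + v) (delta_mx 0 i) -
                 'd (local p.1 c c') (c p.2) (delta_mx 0 i)| <= eta].
Proof.
move=> Sc Sc' cx c'x eta0; have eta2 : 0 < eta / 2 by rewrite divr_gt0.
have [[A B] [/= nA nB] AB] := fiber_joint_continuity Sc Sc' cx c'x eta2.
have [r r0 rB] := nbhs_le_norm nB.
have r2 : 0 < r / 2 by rewrite divr_gt0.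
have Bc y v : `|y - c x0| <= r / 2 -> `|v| <= r / 2 -> B (y + v).
  move=> yr vr; apply: rB; rewrite addrAC [r]splitr.
  by apply: (le_trans (ler_normD _ _)); apply: lerD.
exists (r / 2) => //; exists (A, [set x | `|c x - c x0| <= r / 2]).
  split=> //=; have /cvgrPdistC_le/(_ _ r2) := chart_map_continuous cx.
  by apply.
move=> [w x] /= [Aw xr] v vr.
have [cv c'v _ Dv] := AB (w, c x + v) (conj Aw (Bc _ _ xr vr)).
split; [exact: cv|exact: c'v|move=> i].
have r20 : `|0 : 'rV[R]_n| <= r / 2 by rewrite normr0 ltW.
have Bx := Bc _ _ xr r20; rewrite addr0 in Bx.
have [_ _ _ D0] := AB (w, c x) (conj Aw Bx).
rewrite [eta]splitr -(subrKA ('d (local w0 c c') (c x0) (delta_mx 0 i))).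
apply: (le_trans (ler_normD _ _)); apply: lerD; first exact: Dv.
by rewrite distrC; exact: D0.
Qed.

End JointContinuity.

(** * Shadowing for the fiber maps *)

Lemma seq_uniform (R : realType) (I : eqType) (D : seq I) (Q : R -> I -> Prop) :
  (forall r s i, 0 < r -> r <= s -> Q s i -> Q r i) ->
  (forall i, i \in D -> exists2 r, 0 < r & Q r i) ->
  exists2 r, 0 < r & forall i, i \in D -> Q r i.
Proof.
move=> mono; elim: D => [|i D IH] H; first by exists 1.
have [|r r0 Qr] := IH; first by move=> j jD; apply: H; rewrite inE jD orbT.
have [|s s0 Qs] := H i; first by rewrite inE eqxx.
have m0 : 0 < Num.min r s by rewrite lt_min r0.
exists (Num.min r s) => // j; rewrite inE => /predU1P[->|jD].
  by apply: mono Qs => //; rewrite ge_min lexx orbT.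
by apply: mono (Qr _ jD) => //; rewrite ge_min lexx.
Qed.

Lemma compact_uniform (R : realType) (X : topologicalType) (K : set X)
    (Q : R -> X -> Prop) : compact K ->
  (forall r s x, 0 < r -> r <= s -> Q s x -> Q r x) ->
  (forall x, K x -> exists2 r, 0 < r & \forall y \near x, Q r y) ->
  exists2 r, 0 < r & forall x, K x -> Q r x.
Proof.
move=> /compact_near_coveringP cK mono loc.
have [|r /= r0 rQ] := cK R (0^'+) (fun r x => Q r x) _.
  move=> x /loc[r r0 Qr]; exists ([set y | Q r y], [set s | 0 < s <= r]).
    split => //=; near=> s; apply/andP; split => //.
    by near: s; exact: nbhs_right_le.
  by move=> [y s] /= [Qy /andP[s0 sr]]; exact: mono sr Qy.
exists (r / 2); first by rewrite divr_gt0.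
apply: rQ; last by rewrite divr_gt0.
rewrite /ball_/= sub0r normrN gtr0_norm ?divr_gt0//.
by rewrite ltr_pdivrMr// ltr_pMr// ltr1n.
Unshelve. all: by end_near. Qed.

(** A Lebesgue number argument: sufficiently close points share one of the neighbourhoods [N]. *)
Lemma compact_uniform_pair (R : realType) (X : pseudoMetricType R) (K : set X)
    (Q : X -> X -> Prop) : compact K ->
  (forall x, K x -> exists2 N, nbhs x N & forall y z, N y -> N z -> Q y z) ->
  exists2 r, 0 < r & forall x y, K x -> ball x r y -> Q x y.
Proof.
move=> cK loc.
have [|x Kx|r r0 rQ] :=
  @compact_uniform R X K (fun r x => forall y, ball x r y -> Q x y) cK.
- by move=> r s x r0 rs H y xy; apply: H; exact: le_ball xy.
- have [N nN NQ] := loc x Kx.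
  have [r /= r0 rN] : nbhs_ball x N by rewrite nbhs_ballE.
  have r2 : 0 < r / 2 by rewrite divr_gt0.
  exists (r / 2) => //; apply: filterS (nbhsx_ballx x _ r2) => y xy z yz.
  apply: NQ; apply: rN; last by rewrite [r]splitr; exact: ball_triangle yz.
  by apply: le_ball xy; rewrite ler_pdivrMr// ler_pMr// ler1n.
- by exists r => // x y Kx; exact: rQ.
Qed.

(** Balls of radius [r a / 4] cover, [K a] is the closure of the ball of radius [r a / 2], and [G a]
    holds on the ball of radius [r a]. The margin [rho] allows a jump without leaving the assigned
    compact set. *)
Lemma finite_compact_cover (R : realType) (X : pseudoMetricType R)
    (G : X -> X -> Prop) : compact [set: X] ->
  (forall a, \forall x \near a, G a x) ->
  exists (D : seq X) (asg : X -> X) (K : X -> set X) (rho : R),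
    [/\ 0 < rho, forall a, compact (K a) /\ closed (K a), forall a, K a `<=` G a,
        forall x, asg x \in D & forall x y, ball x rho y -> K (asg x) y].
Proof.
move=> cX loc.
have /choice[r rP] : forall a, exists r, 0 < r /\ (forall x, ball a r x -> G a x).
  move=> a; have [r /= r0 rG] : nbhs_ball a (G a) by rewrite nbhs_ballE; exact: loc.
  by exists r.
have r0 a : 0 < r a by have [] := rP a.
have r4 a : 0 < r a / 4 by rewrite divr_gt0.
(* Finite lists directed by inclusion: for this filter the near-covering form of compactness
   produces a finite subcover. *)
pose large : set_system (seq X) := fun A => exists L : seq X,
  forall L' : seq X, {subset L <= L'} -> A L'.
have flarge : Filter large.
  split; first by exists [::].
  - move=> A B [L LA] [L' LB]; exists (L ++ L') => L'' sub; split.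
      by apply: LA => x xL; apply: sub; rewrite mem_cat xL.
    by apply: LB => x xL; apply: sub; rewrite mem_cat xL orbT.
  - by move=> A B AB [L LA]; exists L => L' /LA /AB.
have [D cov] : exists D : seq X, forall x, exists2 a, a \in D & ball a (r a / 4) x.
  have /compact_near_coveringP/(_ _ large
    (fun L x => exists2 a, a \in L & ball a (r a / 4) x) flarge)[] := cX.
    move=> x _; exists (ball x (r x / 4), [set L : seq X | x \in L]).
      split => /=; first exact: nbhsx_ballx.
      by exists [:: x] => L; apply; rewrite inE.
    by move=> [y L] /= [xy xL]; exists x.
  by move=> D DP; exists D => x; exact: (DP D).
have [||rho rho0 rhoD] := @seq_uniform R X D (fun s a => s <= r a / 4).
- by move=> s t a _ st; exact: le_trans.
- by move=> a _; exists (r a / 4).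
have /choice[asg asgP] : forall x, exists a, a \in D /\ ball a (r a / 4) x.
  by move=> x; have [a aD xa] := cov x; exists a.
exists D, asg, (fun a => closure (ball a (r a / 2))), rho; split => //.
- move=> a; split; last exact: closed_closure.
  by apply: subclosed_compact cX _ => //; exact: closed_closure.
- move=> a x /(_ (ball x (r a / 2)))[|y [ay xy]]; first by apply: nbhsx_ballx; rewrite divr_gt0.
  apply: (rP a).2; rewrite [r a]splitr; exact: ball_triangle ay (ball_sym xy).
- by move=> x; have [] := asgP x.
- move=> x y xy; apply: subset_closure; have [aD ax] := asgP x.
  rewrite (_ : r (asg x) / 2 = r (asg x) / 4 + r (asg x) / 4); last by field.
  by apply: ball_triangle ax _; apply: le_ball xy; exact: rhoD.
Qed.

(** * Matching the splittings on the two sides of a jump *)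

Section Splice.
Context (R : realType) (n : nat).
Local Notation V := 'rV[R]_n.
(** [P] and [nu] belong to a point of the pseudo-orbit, [P'] and [nu'] to its image, [Q] and [nuq]
    to the next point. [D] is the derivative, and [t] measures the mismatch caused by the jump. *)
Context (P P' D : 'End(V)) (Q : 'End(V)) (nu nu' nuq : V -> R) (C mu t : R).
Hypothesis P'_proj : forall v, P' (P' v) = P' v.
Hypothesis Q_proj : forall v, Q (Q v) = Q v.
Hypothesis P'_le : forall v, `|P' v| <= C * `|v|.
Hypothesis PQ_le : forall v, `|Q v - P' v| <= t * `|v|.
Hypothesis nuq_triangle : forall u v, nuq (u + v) <= nuq u + nuq v.
Hypothesis nu'_ge : forall v, `|v| <= C * nu' v.
Hypothesis nuq_le : forall v, nuq v <= C * `|v|.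
Hypothesis nuq_nu' : forall v, nuq v <= (1 + t) * nu' v /\ nu' v <= (1 + t) * nuq v.
Hypothesis C_gt0 : 0 < C.
Hypothesis mu_gt0 : 0 < mu.
Hypothesis t_ge0 : 0 <= t.
Hypothesis t_le1 : t <= 1.
Hypothesis t_small : t * (2 * mu^-1 * (C ^+ 2 * (2 * C + 1)) + 1 + C ^+ 2 * (2 * C + 1))
  <= mu^-1 - 1.

(* A linear map carrying the splitting defined by [P'] to the one defined by
   [Q], and close to the identity when the two splittings are close. *)
Definition splice : 'End(V) := ((Q \o P') + ((\1 - Q) \o (\1 - P')))%VF.

Lemma spliceE v : splice v = Q (P' v) + (v - P' v - Q (v - P' v)).
Proof.
by rewrite /splice add_lfunE !comp_lfunE !add_lfunE !opp_lfunE !id_lfunE.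
Qed.

Lemma splice_proj v : Q (splice v) = splice (P' v).
Proof.
rewrite !spliceE P'_proj subrr (linear0 Q) subr0 addr0.
by rewrite (linearD Q)/= (linearB Q)/= !Q_proj subrr addr0.
Qed.

Lemma splice_near v : `|splice v - v| <= t * (2 * C + 1) * `|v|.
Proof.
(* The difference of [Q] and [P'] acts on the two components of [v]. *)
have -> : splice v - v =
    (Q (P' v) - P' (P' v)) - (Q (v - P' v) - P' (v - P' v)).
  have P'C : P' (v - P' v) = 0 by rewrite (linearB P')/= P'_proj subrr.
  rewrite spliceE P'_proj P'C; move: (Q (P' v)) (P' v) (Q (v - P' v)) => a b c.
  by apply/rowP => i; rewrite !mxE; ring.
have e1 := PQ_le (P' v); have e2 := PQ_le (v - P' v).
have e3 : `|v - P' v| <= `|v| + C * `|v|.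
  by rewrite (le_trans (ler_normB _ _))// lerD2l.
have e4 : t * `|P' v| <= t * (C * `|v|) by rewrite ler_wpM2l.
have e5 : t * `|v - P' v| <= t * (`|v| + C * `|v|) by rewrite ler_wpM2l.
rewrite (le_trans (ler_normB _ _))// (le_trans (lerD e1 e2))//.
by rewrite (le_trans (lerD e4 e5))// le_eqVlt; apply/orP; left; apply/eqP; ring.
Qed.

Let m : R := C ^+ 2 * (2 * C + 1).

Let m_ge0 : 0 <= m.
Proof. by rewrite mulr_ge0 ?exprn_ge0 ?addr_ge0 ?mulr_ge0 ?(ltW C_gt0). Qed.

Let nu'_ge0 v : 0 <= nu' v.
Proof. by rewrite -(pmulr_rge0 _ C_gt0) (le_trans _ (nu'_ge v)). Qed.

Let nuq_diff v : nuq (splice v - v) <= t * m * nu' v /\ nuq (v - splice v) <= t * m * nu' v.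
Proof.
have : C * `|splice v - v| <= t * m * nu' v.
  rewrite (le_trans (ler_wpM2l (ltW C_gt0) (splice_near v)))//.
  have := nu'_ge v => /(ler_wpM2l (_ : 0 <= C * (t * (2 * C + 1)))) H.
  rewrite [leLHS](_ : _ = C * (t * (2 * C + 1)) * `|v|); last by ring.
  rewrite (le_trans (H _)) ?mulr_ge0 ?addr_ge0 ?mulr_ge0 ?(ltW C_gt0)//.
  by rewrite /m le_eqVlt; apply/orP; left; apply/eqP; ring.
by move=> H; split; [|rewrite distrC in H]; exact: le_trans (nuq_le _) H.
Qed.

(** [t_small] is tailored to these inequalities, behind [splice_le] and [splice_ge] respectively. *)
Let kappa_ge1 : 1 + t + t * m <= mu^-1 /\ 1 + t <= mu^-1 * (1 - 2 * (t * m)).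
Proof.
have tm : 0 <= t * m by rewrite mulr_ge0.
have ktm : 0 <= mu^-1 * (t * m) by rewrite mulr_ge0 ?invr_ge0 ?(ltW mu_gt0).
move: t_small; rewrite -/m => H; split.
  by apply: le_trans (_ : 1 + t * (2 * mu^-1 * m + 1 + m) <= _); lra.
by lra.
Qed.

Lemma splice_le v : nuq (splice v) <= mu^-1 * nu' v.
Proof.
rewrite -[X in nuq X](subrKC v) (le_trans (nuq_triangle _ _))//.
rewrite (le_trans (lerD (nuq_nu' v).1 (nuq_diff v).1))// -mulrDl.
by rewrite ler_wpM2r// kappa_ge1.1.
Qed.

(** Replacing [v] by [splice v] costs a small multiple of [nu' v], absorbed on the left; [t <= 1]
    bounds that multiple by [2 * (t * m)]. *)
Lemma splice_ge v : nu' v <= mu^-1 * nuq (splice v).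
Proof.
have tm : 0 <= t * m by rewrite mulr_ge0.
have H : nu' v <= (1 + t) * nuq (splice v) + 2 * (t * m) * nu' v.
  apply: (le_trans (nuq_nu' v).2).
  have : nuq v <= nuq (splice v) + t * m * nu' v.
    rewrite -[X in nuq X <= _](subrKC (splice v)) (le_trans (nuq_triangle _ _))//.
    by rewrite lerD2l (nuq_diff v).2.
  move=> /(ler_wpM2l (_ : 0 <= 1 + t)) -/(_ _)/le_trans; apply; first by rewrite addr_ge0.
  have : (1 + t) * (t * m * nu' v) <= 2 * (t * m * nu' v).
    by apply: ler_wpM2r; [exact: mulr_ge0|rewrite -[2]/(1 + 1) lerD2l].
  by move=> H; rewrite mulrDr lerD2l (le_trans H)// mulrA.
have := kappa_ge1.2; set z := 1 - _; set y := nuq _ => kz.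
have k0 : 0 < mu^-1 by rewrite invr_gt0.
have z0 : 0 < z.
  by rewrite -(pmulr_rgt0 _ k0) (lt_le_trans _ kz)// ltr_pwDl.
have y0 : 0 <= y.
  have : 0 <= z * nu' v by rewrite mulr_ge0// ltW.
  have t1 : 0 < 1 + t by rewrite ltr_pwDl.
  move=> zn; rewrite -(pmulr_rge0 _ t1); move: zn H; rewrite /z -/y; lra.
rewrite -(ler_pM2l z0) mulrCA mulrA.
apply: (@le_trans _ _ ((1 + t) * y)); first by rewrite /z; move: H; rewrite -/y; lra.
by rewrite ler_wpM2r// mulrC.
Qed.

Lemma splice_inj v : splice v = 0 -> v = 0.
Proof.
move=> v0; have := splice_ge v; rewrite v0 => H.
apply/eqP; rewrite -normr_le0 (le_trans (nu'_ge v))// pmulr_rle0//.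
rewrite (le_trans H)// pmulr_rle0 ?invr_gt0// (le_trans (nuq_le 0))//.
by rewrite normr0 mulr0.
Qed.

Lemma splice_onto w : exists v, splice v = w.
Proof.
have ker0 : lker splice == 0%VS.
  rewrite -subv0; apply/subvP => v; rewrite memv_ker => /eqP/splice_inj ->.
  exact: mem0v.
by exists ((splice^-1)%VF w); exact: lker0_lfunVK.
Qed.

(** [D] contracts by [mu ^+ 2] and [splice] loses at most [mu^-1], which leaves [mu]. *)
Lemma splice_stable :
  (forall v, P v = v -> P' (D v) = D v /\ nu' (D v) <= mu ^+ 2 * nu v) ->
  forall v, P v = v ->
    Q ((splice \o D)%VF v) = (splice \o D)%VF v /\ nuq ((splice \o D)%VF v) <= mu * nu v.
Proof.
move=> H v /H[P'D nuD]; rewrite comp_lfunE splice_proj P'D; split => //.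
rewrite (le_trans (splice_le _))// ler_pdivrMl//.
by rewrite (le_trans nuD)// expr2 mulrA.
Qed.

Lemma splice_unstable :
  (forall v, P v = 0 -> P' (D v) = 0 /\ nu v <= mu ^+ 2 * nu' (D v)) ->
  forall v, P v = 0 ->
    Q ((splice \o D)%VF v) = 0 /\ nu v <= mu * nuq ((splice \o D)%VF v).
Proof.
move=> H v /H[P'D nuD]; rewrite comp_lfunE splice_proj P'D linear0; split => //.
rewrite (le_trans nuD)// expr2 -mulrA ler_wpM2l ?(ltW mu_gt0)//.
by rewrite -ler_pdivlMl// splice_ge.
Qed.

Lemma splice_unstable_onto :
  (forall w, P' w = 0 -> exists2 v, P v = 0 & D v = w) ->
  forall w, Q w = 0 -> exists2 v, P v = 0 & (splice \o D)%VF v = w.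
Proof.
move=> H w Qw; have [v vw] := splice_onto w.
have [|u Pu Du] := H v; first by apply: splice_inj; rewrite -splice_proj vw.
by exists u => //; rewrite comp_lfunE Du.
Qed.

End Splice.

Lemma le_mul_subst (R : realType) (a b c d k : R) :
  a = b -> c = d -> b <= k * d -> a <= k * c.
Proof. by move=> -> ->. Qed.

(** What holds near [a] also holds near every point close enough to [a]. *)
Lemma near_interior3 (T : topologicalType) (a : T) (P Q U G : T -> Prop) :
  (\forall p \near a, P p) -> (\forall p \near a, Q p) -> (\forall p \near a, U p) ->
  (forall p, (\forall q \near p, P q) -> (\forall q \near p, Q q) ->
     (\forall q \near p, U q) -> G p) -> \forall p \near a, G p.
Proof.
move=> /nbhs_interior P1 /nbhs_interior Q1 /nbhs_interior U1 H.
by apply: filterS3 P1 Q1 U1; exact: H.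
Qed.

Lemma near_snd (T U : topologicalType) (p : T * U) (Q : U -> Prop) :
  (\forall y \near p.2, Q y) -> \forall q \near p, Q q.2.
Proof. by move=> H; exact: (cvg_snd H). Qed.

Lemma nbhs_setI (T : topologicalType) (p : T) (P Q : set T) :
  nbhs p P -> nbhs p Q -> nbhs p (P `&` Q).
Proof. exact: filterI. Qed.

Lemma continuous_comp_fst (T U W : topologicalType) (f : T -> W) :
  continuous f -> continuous (fun p : T * U => f p.1).
Proof. by move=> cf p; exact: (continuous_comp cvg_fst (cf p.1)). Qed.

Lemma continuous_comp_snd (T U W : topologicalType) (f : T * U -> T * W) (w : T) :
  continuous f -> continuous (fun x => (f (w, x)).2).
Proof.
move=> cf x; have c1 : {for x, continuous (fun y : U => (w, y))}.
  by apply: cvg_pair; [exact: cvg_cst|exact: cvg_id].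
have c2 := continuous_comp c1 (cf _).
exact: (continuous_comp c2 cvg_snd).
Qed.

Lemma continuous_pair (T U W : topologicalType) (f : T -> U) (h : T -> W) :
  continuous f -> continuous h -> continuous (fun x => (f x, h x)).
Proof. by move=> cf ch x; apply: cvg_pair; [exact: cf|exact: ch]. Qed.

Lemma near_pair (T U W : topologicalType) (c : U -> W) (w : T) (x : U) (Q : T * W -> Prop) :
  {for x, continuous c} -> (\forall z \near (w, c x), Q z) ->
  \forall q \near (w, x), Q (q.1, c q.2).
Proof.
move=> cc [[A B] [/= nA nB] AB]; exists (A, c @^-1` B).
  by split => //=; exact: cc.
by move=> [t u] /= [At Bu]; exact: (AB (t, c u)).
Qed.

Lemma ler_norm_subD (R : realType) (V : normedModType R) (x y : V) :
  `|x| <= `|x - y| + `|y|.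
Proof. by rewrite -[X in `|X| <= _](subrK y) ler_normD. Qed.

Lemma small_factor (R : realType) (L B c : R) : 0 < L -> 0 < B -> 0 < c ->
  exists t, [/\ 0 < t, t <= 1, t * L <= c & B * t <= 1 / 4].
Proof.
move=> L0 B0 c0; exists (Num.min 1 (Num.min (c / L) (1 / 4 / B))); split.
- by rewrite !lt_min ltr01 !divr_gt0.
- by rewrite ge_min lexx.
- by rewrite -ler_pdivlMr// !ge_min lexx orbT.
- by rewrite mulrC -ler_pdivlMr// !ge_min lexx !orbT.
Qed.

Lemma continuous_iter (T : topologicalType) (f : T -> T) k :
  continuous f -> continuous (iter k f).
Proof.
move=> cf; elim: k => [|k IH] x; first exact: cvg_id.
exact: (continuous_comp (IH x) (cf _)).
Qed.

(** Take a cluster point of the finite solutions: for each [k], a solution with [k <= N] comes close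
    enough to it for continuity of [h k] to transfer the estimate. *)
Lemma compact_shadowing (R : realType) (M : metricType R) (h : nat -> M -> M)
    (q : nat -> M) (e : R) : compact [set: M] -> (forall k, continuous (h k)) -> 0 < e ->
  (forall N, exists z, forall k, (k <= N)%N -> ball (q k) (e / 2) (h k z)) ->
  exists z, forall k, ball (q k) e (h k z).
Proof.
move=> M_compact hc e0 /choice[z zP].
have [] := M_compact (z @ \oo) _; first by exists 0%N.
move=> z0 [_ cl]; exists z0 => k.
have n1 : (z @ \oo) (z @` [set N | (k <= N)%N]) by exists k => // N kN; exists N.
have n2 : nbhs z0 (h k @^-1` ball (h k z0) (e / 2)).
  by apply: (hc k z0); apply: nbhsx_ballx; rewrite divr_gt0.
have [y [[N kN <-] By]] := cl _ _ n1 n2.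
by rewrite [e]splitr; apply: ball_triangle (zP N k kN) _; exact: ball_sym.
Qed.

(** * Hyperbolicity of the fiber maps in finitely many charts *)

Section Fibers.
Context (R : realType) (M : metricType R) (n : nat) (S : smooth_structure R M n).
Context (g : riemannian_metric S) (Omega : pmetricType R) (theta : Omega -> Omega).
Context (F : Omega -> diff2 S) (Es Eu : Omega * M -> {vspace 'rV[R]_n}).
Context (lambda : R).
Local Notation X := (Omega * M)%type.
Local Notation V := 'rV[R]_n.
Local Notation Theta := (Defs.skew theta F).

Hypothesis Es_continuous : continuous_subbundle S Es.
Hypothesis Eu_continuous : continuous_subbundle S Eu.
Hypothesis E_direct : forall p, (Es p :&: Eu p = 0)%VS /\ (Es p + Eu p = fullv)%VS.
Hypothesis Eu_invariant : forall p,
  (tangent_map S (F p.1) p.2 @: Eu p = Eu (Theta p))%VS.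
Hypothesis Es_invariant : forall p,
  (tangent_map S (F p.1) p.2 @: Es p = Es (Theta p))%VS.
Hypothesis Eu_expansion : forall p xi, xi \in Eu p ->
  expR lambda * tangent_norm g p.2 xi
  <= tangent_norm g (Theta p).2 (tangent_map S (F p.1) p.2 xi).
Hypothesis Es_contraction : forall p eta, eta \in Es p ->
  tangent_norm g (Theta p).2 (tangent_map S (F p.1) p.2 eta)
  <= expR (- lambda) * tangent_norm g p.2 eta.

(** Here [a] is the index of a chart, in which everything at nearby points [p] is expressed. *)
Definition base_chart (a : X) := chart_at S a.2.

Definition coord_space (a : X) (E : X -> {vspace V}) (p : X) : {vspace V} :=
  (tangent_coord S (base_chart a) p.2 @: E p)%VS.

Definition coord_proj (a p : X) : 'End(V) :=
  daddv_pi (coord_space a Es p) (coord_space a Eu p).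

Definition coord_norm (a p : X) (v : V) : R := chart_norm g (base_chart a) p.2 v.

Definition coord_map (a b : X) (w : Omega) : V -> V :=
  base_chart b \o F w \o chart_inv (base_chart a).

Definition coord_deriv (a b p : X) : 'End(V) :=
  linfun ('d (coord_map a b p.1) (base_chart a p.2)).

Local Notation inside a p := (chart_dom (base_chart a) p.2).

Lemma base_chart_atlas a : atlas S (base_chart a).
Proof. exact: chart_at_atlas. Qed.

Lemma coord_derivE a b p v :
  coord_deriv a b p v = 'd (coord_map a b p.1) (base_chart a p.2) v.
Proof. by rewrite lfunE. Qed.

Lemma coord_space_direct a p : inside a p ->
  (coord_space a Es p :&: coord_space a Eu p = 0)%VS /\
  (coord_space a Es p + coord_space a Eu p = fullv)%VS.
Proof.
move=> ap; rewrite /coord_space.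
have ker0 : lker (tangent_coord S (base_chart a) p.2) == 0%VS.
  apply/lker0P; apply: can_inj; exact: (tangent_coordK (base_chart_atlas a) ap).
have [E0 ET] := E_direct p.
by rewrite -limgD ET (lker0_limgf ker0) -(lker0_img_cap _ _ ker0) E0 limg0.
Qed.

Lemma coord_projP a p v : inside a p ->
  (coord_proj a p v = v <-> v \in coord_space a Es p) /\
  (coord_proj a p v = 0 <-> v \in coord_space a Eu p).
Proof.
move=> /coord_space_direct[E0 ET]; have [Ps Pu] := daddv_piP v E0 ET.
split; split.
- by move=> <-.
- by move=> vE; rewrite /coord_proj daddv_pi_id.
- by move=> Pv; move: Pu; rewrite -/(coord_proj a p) Pv subr0.
- by move=> vE; rewrite -[v]add0r /coord_proj daddv_pi_uniq ?mem0v.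
Qed.

Lemma coord_proj_proj a p v : inside a p -> coord_proj a p (coord_proj a p v) = coord_proj a p v.
Proof. by move=> /coord_space_direct[E0 _]; exact: daddv_pi_proj. Qed.

Lemma coord_deriv_tangent a b p v : inside a p -> inside b (Theta p) ->
  coord_deriv a b p (tangent_coord S (base_chart a) p.2 v) =
  tangent_coord S (base_chart b) (Theta p).2 (tangent_map S (F p.1) p.2 v).
Proof.
move=> ap bp; apply: (etrans (coord_derivE _ _ _ _)).
exact: (tangent_map_coord _ (base_chart_atlas a) (base_chart_atlas b) ap bp).
Qed.

Lemma coord_norm_tangent a p v : inside a p ->
  coord_norm a p (tangent_coord S (base_chart a) p.2 v) = tangent_norm g p.2 v.
Proof.
move=> ap; congr (tangent_norm g p.2 _).
exact: (tangent_coordK (base_chart_atlas a) ap).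
Qed.

Lemma coord_stable a b p : inside a p -> inside b (Theta p) ->
  forall v, coord_proj a p v = v ->
    coord_proj b (Theta p) (coord_deriv a b p v) = coord_deriv a b p v /\
    coord_norm b (Theta p) (coord_deriv a b p v) <= expR (- lambda) * coord_norm a p v.
Proof.
move=> ap bp v /(coord_projP _ ap).1.1 /memv_imgP[w wE vE].
have E1 := etrans (congr1 (coord_deriv a b p) vE) (coord_deriv_tangent w ap bp).
have E2 := etrans (congr1 (coord_norm a p) vE) (coord_norm_tangent w ap).
have E3 := etrans (congr1 (coord_norm b (Theta p)) E1) (coord_norm_tangent _ bp).
split; last exact: (le_mul_subst E3 E2 (Es_contraction wE)).
apply: (coord_projP _ bp).1.2.
apply: (eq_ind_r (fun y => y \in coord_space b Es (Theta p)) _ E1).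
apply: memv_img; rewrite -Es_invariant; exact: memv_img.
Qed.

Lemma coord_unstable a b p : inside a p -> inside b (Theta p) ->
  forall v, coord_proj a p v = 0 ->
    coord_proj b (Theta p) (coord_deriv a b p v) = 0 /\
    coord_norm a p v <= expR (- lambda) * coord_norm b (Theta p) (coord_deriv a b p v).
Proof.
move=> ap bp v /(coord_projP _ ap).2.1 /memv_imgP[w wE vE].
have E1 := etrans (congr1 (coord_deriv a b p) vE) (coord_deriv_tangent w ap bp).
have E2 := etrans (congr1 (coord_norm a p) vE) (coord_norm_tangent w ap).
have E3 := etrans (congr1 (coord_norm b (Theta p)) E1) (coord_norm_tangent _ bp).
have exp : tangent_norm g p.2 w <=
    expR (- lambda) * tangent_norm g (Theta p).2 (tangent_map S (F p.1) p.2 w).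
  by rewrite expRN ler_pdivlMl ?expR_gt0//; exact: Eu_expansion.
split; last exact: (le_mul_subst E2 E3 exp).
apply: (coord_projP _ bp).2.2.
apply: (eq_ind_r (fun y => y \in coord_space b Eu (Theta p)) _ E1).
apply: memv_img; rewrite -Eu_invariant; exact: memv_img.
Qed.

Lemma coord_unstable_onto a b p : inside a p -> inside b (Theta p) ->
  forall w, coord_proj b (Theta p) w = 0 ->
    exists2 v, coord_proj a p v = 0 & coord_deriv a b p v = w.
Proof.
move=> ap bp w /(coord_projP _ bp).2.1 /memv_imgP[u uE wE].
move: uE; rewrite -Eu_invariant => /memv_imgP[v vE uE].
exists (tangent_coord S (base_chart a) p.2 v).
  by apply: (coord_projP _ ap).2.2; exact: memv_img.
apply: (etrans (coord_deriv_tangent v ap bp)).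
by apply: (etrans _ (esym wE)); congr (tangent_coord _ _ _ _).
Qed.

Definition proj_continuous_at a p := forall d, 0 < d ->
  \forall q \near p, forall v,
    `|coord_proj a q v - coord_proj a p v| <= d * `|v|.

(** Continuity is needed at all [p] near [a], as the compact pieces contain such points. The frames
    of [continuous_subbundle] are continuous at each of them. *)
Lemma coord_proj_near a : \forall p \near a, inside a p /\ proj_continuous_at a p.
Proof.
have [k [e He]] := Es_continuous a; have [l [h Hh]] := Eu_continuous a.
have Ha : \forall p \near a, inside a p.
  have : nbhs a.2 (chart_dom (base_chart a)) by apply: chart_dom_nbhs; exact: chart_at_dom.
  exact: cvg_snd.
apply: (near_interior3 He Hh Ha) => p Ep Hp ap.
split; first exact: nbhs_singleton ap.
move=> d d0.
have [ce _] := nbhs_singleton Ep; have [ch _] := nbhs_singleton Hp.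
apply: (daddv_pi_near d0 ce ch).
apply: (near_interior3 Ep Hp ap) => q /nbhs_singleton[_ bE] /nbhs_singleton[_ bH] /nbhs_singleton aq.
have [E0 ET] := coord_space_direct aq; split; [exact: bE|exact: bH|exact: E0|exact: ET].
Qed.

Hypothesis M_compact : compact [set: M].
Hypothesis Omega_compact : compact [set: Omega].
Hypothesis F_continuous : continuous F.
Hypothesis theta_continuous : continuous theta.

Lemma total_compact : compact [set: X].
Proof. by rewrite -setXTT; exact: compact_setX. Qed.

Lemma skew_continuous : continuous Theta.
Proof.
apply: continuous_pair; last exact: fiber_map_continuous.
exact: continuous_comp_fst.
Qed.

Definition adapted a p := inside a p /\ proj_continuous_at a p.

Lemma coord_norm_ge0 a p v : 0 <= coord_norm a p v.
Proof. exact: sqrtr_ge0. Qed.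

Definition bounded_by a C p := forall v,
  [/\ `|coord_proj a p v| <= C * `|v|, `|v| <= C * coord_norm a p v &
      coord_norm a p v <= C * `|v|].

Lemma bounded_by_le a C C' p : C <= C' -> bounded_by a C p -> bounded_by a C' p.
Proof.
move=> CC H v; have [h1 h2 h3] := H v; split.
- by apply: (le_trans h1); apply: ler_wpM2r.
- by apply: (le_trans h2); apply: ler_wpM2r => //; exact: coord_norm_ge0.
- by apply: (le_trans h3); apply: ler_wpM2r.
Qed.

Section OneChart.
Context (a : X) (K : set X).
Hypothesis K_compact : compact K.
Hypothesis K_adapted : K `<=` adapted a.

(** A bound written [r^-1] weakens as [r] decreases, which is the monotonicity required by
    [compact_uniform]. *)
Lemma uniform_bounds : exists2 r, 0 < r & forall p, K p -> bounded_by a r^-1 p.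
Proof.
apply: (compact_uniform (Q := fun r => bounded_by a r^-1) K_compact) => [r s p r0 rs H|p Kp].
  by apply: bounded_by_le H; rewrite lef_pV2// posrE// (lt_le_trans r0).
have [ap cp] := K_adapted Kp.
have [C C0 HC] := chart_norm_bound g (base_chart_atlas a) ap.
pose C1 : R := \sum_i `|coord_proj a p (delta_mx 0 i)|.
have C10 : 0 <= C1 by apply: sumr_ge0.
have HC' := near_snd HC.
have r0 : 0 < C + (1 + C1) by rewrite addr_gt0// ltr_wpDr.
exists (C + (1 + C1))^-1; first by rewrite invr_gt0.
apply: filterS2 HC' (cp 1 ltr01) => q Hq Pq v; have [vq qv] := Hq v.
rewrite invrK; split.
- rewrite -(subrK (coord_proj a p v) (coord_proj a q v)).
  apply: (le_trans (ler_normD _ _)).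
  apply: (@le_trans _ _ ((1 + C1) * `|v|)); last first.
    by apply: ler_wpM2r => //; rewrite lerDr ltW.
  rewrite mulrDl; apply: lerD; [exact: Pq|exact: linear_norm_le].
- apply: (le_trans vq); apply: ler_wpM2r; first exact: coord_norm_ge0.
  by rewrite lerDl addr_ge0.
- by apply: (le_trans qv); apply: ler_wpM2r => //; rewrite lerDl addr_ge0.
Qed.

Lemma uniform_variation t : 0 < t -> t <= 1 -> exists2 r, 0 < r &
  forall p q, K p -> ball p r q -> forall v,
    `|coord_proj a q v - coord_proj a p v| <= t * `|v| /\
    (coord_norm a q v <= (1 + t) * coord_norm a p v /\
     coord_norm a p v <= (1 + t) * coord_norm a q v).
Proof.
(* Both points are compared with a third one, so two errors combine: [2 * s <= t] and
   [(1 + s) * (1 + s) <= 1 + t]. *)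
move=> t0 t1; pose s := t / 3; have s0 : 0 < s by rewrite divr_gt0.
have ss : (1 + s) * (1 + s) <= 1 + t.
  have : s * s <= s * 1 by rewrite ler_pM2l// /s; lra.
  by rewrite /s; lra.
apply: (compact_uniform_pair K_compact) => p Kp; have [ap cp] := K_adapted Kp.
have H := near_snd (chart_norm_near g (base_chart_atlas a) ap s0).
refine (ex_intro2 _ _ _ (nbhs_setI (cp s s0) H) _).
move=> q q' [/= Pq Nq] [/= Pq' Nq'] v.
split.
  rewrite -(subrKA (coord_proj a p v)) (le_trans (ler_normD _ _))//.
  rewrite [X in _ + X]distrC (le_trans (lerD (Pq' v) (Pq v)))// -mulrDl.
  by rewrite ler_wpM2r// /s; lra.
have chain x y z : 0 <= z -> x <= (1 + s) * y -> y <= (1 + s) * z -> x <= (1 + t) * z.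
  move=> z0 xy yz; apply: (le_trans xy).
  have s1 : 0 <= 1 + s by rewrite addr_ge0// ltW.
  by apply: (le_trans (ler_wpM2l s1 yz)); rewrite mulrA ler_wpM2r.
have [h1 h2] := Nq v; have [h3 h4] := Nq' v.
split; first exact: (chain _ _ _ (coord_norm_ge0 _ _ _) h3 h2).
exact: (chain _ _ _ (coord_norm_ge0 _ _ _) h1 h4).
Qed.

Lemma uniform_inverse e : 0 < e -> exists2 r, 0 < r & forall p, K p ->
  forall v, `|v| <= r -> chart_cod (base_chart a) (base_chart a p.2 + v) /\
    ball p.2 e (chart_inv (base_chart a) (base_chart a p.2 + v)).
Proof.
move=> e0; pose Q r (p : X) := forall v, `|v| <= r ->
  chart_cod (base_chart a) (base_chart a p.2 + v) /\
    ball p.2 e (chart_inv (base_chart a) (base_chart a p.2 + v)).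
apply: (compact_uniform (Q := Q) K_compact) => [r s p r0 rs H v vr|p Kp].
  by apply: H; exact: le_trans rs.
have [ap _] := K_adapted Kp; have e2 : 0 < e / 2 by rewrite divr_gt0.
have [r r0 Hr] := nbhs_le_norm (chart_inv_nearP ap (nbhsx_ballx p.2 _ e2)).
have r2 : 0 < r / 2 by rewrite divr_gt0.
exists (r / 2) => //; have /cvgrPdistC_le/(_ _ r2)/near_snd Hc := chart_map_continuous ap.
apply: filterS2 Hc (near_snd (nbhsx_ballx p.2 _ e2)) => q qp pq v vr.
have [|cv bv] := Hr (base_chart a q.2 + v).
  rewrite addrAC [r]splitr; apply: (le_trans (ler_normD _ _)); exact: lerD.
by split=> //; rewrite [e]splitr; apply: ball_triangle (ball_sym pq) bv.
Qed.

Lemma uniform_chart e : 0 < e -> exists2 r, 0 < r &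
  forall p q, K p -> ball p r q -> inside a q /\
    `|base_chart a q.2 - base_chart a p.2| <= e.
Proof.
move=> e0; apply: (compact_uniform_pair K_compact) => p Kp.
have [ap _] := K_adapted Kp; have e2 : 0 < e / 2 by rewrite divr_gt0.
have /cvgrPdistC_le/(_ _ e2)/near_snd Hc := chart_map_continuous ap.
refine (ex_intro2 _ _ _ (nbhs_setI Hc (near_snd (chart_dom_nbhs ap))) _).
move=> q q' [/= hq aq] [/= hq' aq']; split => //.
rewrite -(subrKA (base_chart a p.2)) [e]splitr (le_trans (ler_normD _ _))//.
by rewrite lerD// distrC.
Qed.

End OneChart.

Section TwoCharts.
Context (a b : X) (Ka Kb : set X).
Hypothesis Ka_compact : compact Ka.
Hypothesis Kb_closed : closed Kb.
Hypothesis Ka_adapted : Ka `<=` adapted a.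
Hypothesis Kb_adapted : Kb `<=` adapted b.

Let Kab_compact : compact (Ka `&` Theta @^-1` Kb).
Proof.
apply: compact_closedI => //; apply: preimage_closed => // p _.
exact: skew_continuous.
Qed.

Lemma uniform_deriv_bound : exists2 r, 0 < r & forall p, (Ka `&` Theta @^-1` Kb) p ->
  forall v, `|coord_deriv a b p v| <= r^-1 * `|v|.
Proof.
pose Q r p := forall v, `|coord_deriv a b p v| <= r^-1 * `|v|.
apply: (compact_uniform (Q := Q) Kab_compact) => [r s p r0 rs H v|[w x] [Kp Kq]].
  have rs1 : s^-1 <= r^-1 by rewrite lef_pV2// posrE// (lt_le_trans r0).
  by apply: (le_trans (H v)); apply: ler_wpM2r.
have [ap _] := Ka_adapted Kp; have [bp _] := Kb_adapted Kq.
have J := fiber_joint_continuity M_compact F_continuous (base_chart_atlas a)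
  (base_chart_atlas b) ap bp ltr01.
pose L : R := \sum_i `|coord_deriv a b (w, x) (delta_mx 0 i)|.
have L0 : 0 <= L by apply: sumr_ge0.
have c0 : 0 < n%:R + L + 1 :> R by rewrite ltr_wpDl ?addr_ge0.
exists (n%:R + L + 1)^-1; first by rewrite invr_gt0.
have Hc := near_pair (chart_map_continuous ap) J.
apply: filterS Hc => q /= [_ _ _ Dq] v; rewrite invrK.
apply: (le_trans (linear_norm_le _ _)); apply: ler_wpM2r => //.
apply: (@le_trans _ _ (n%:R + L)); last by rewrite lerDl.
rewrite -[X in X%:R + _](card_ord n) -sumr_const -big_split/=; apply: ler_sum => i _.
apply: (le_trans (ler_norm_subD _ (coord_deriv a b (w, x) (delta_mx 0 i)))).
apply: lerD; last exact: lexx.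
apply: (eq_ind_r (fun y => `|y - _| <= 1) _ (coord_derivE a b q (delta_mx 0 i))).
apply: (eq_ind_r (fun y => `|_ - y| <= 1) _ (coord_derivE a b (w, x) (delta_mx 0 i))).
exact: Dq.
Qed.

Lemma uniform_nonlinearity eta : 0 < eta -> exists2 r, 0 < r &
  forall p, (Ka `&` Theta @^-1` Kb) p ->
    (forall v, `|v| <= r ->
       inside b (p.1, F p.1 (chart_inv (base_chart a) (base_chart a p.2 + v)))) /\
    forall u v, `|u| <= r -> `|v| <= r ->
      `|coord_map a b p.1 (base_chart a p.2 + u) - coord_map a b p.1 (base_chart a p.2 + v) -
        coord_deriv a b p (u - v)| <= n%:R * eta * `|u - v|.
Proof.
move=> eta0; pose Q r (p : X) := forall v, `|v| <= r ->
  [/\ chart_cod (base_chart a) (base_chart a p.2 + v),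
      inside b (p.1, F p.1 (chart_inv (base_chart a) (base_chart a p.2 + v))) &
      forall i, `|'d (coord_map a b p.1) (base_chart a p.2 + v) (delta_mx 0 i) -
                  'd (coord_map a b p.1) (base_chart a p.2) (delta_mx 0 i)| <= eta].
have [|[w x] [Kp Kq]|r r0 Qr] := @compact_uniform _ _ _ Q Kab_compact.
- by move=> r s p r0 rs H v vr; apply: H; exact: le_trans rs.
- have [ap _] := Ka_adapted Kp; have [bp _] := Kb_adapted Kq.
  exact: (fiber_local_uniform M_compact F_continuous (base_chart_atlas a)
    (base_chart_atlas b) ap bp eta0).
exists r => // p Kp; have H := Qr p Kp; split=> [v vr|u v ur vr].
  by have [] := H v vr.
apply: (eq_ind_r (fun y => `|_ - y| <= _) _ (coord_derivE a b p (u - v))).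
apply: (mean_value_le (r := r)) => // y yr; have [cy by_ Dy] := H y yr; split=> //.
have := diff2_differentiable (base_chart_atlas a) (base_chart_atlas b) (chart_cod_dom cy) by_.
by rewrite chart_invK.
Qed.

End TwoCharts.

Hypothesis lambda_gt0 : 0 < lambda.

(** The constants are fixed in the order [C], [t], [eta], [r], [d], [delta], all before the
    pseudo-orbit and [N]. *)
Lemma pseudo_orbit_shadowing e : 0 < e -> exists2 delta, 0 < delta &
  forall p : nat -> X, (forall k, (p k.+1).1 = theta (p k).1) ->
    (forall k, ball (Theta (p k)) delta (p k.+1)) ->
    forall N, exists z, forall k, (k <= N)%N ->
      ball (p k).2 e (iter k Theta ((p 0%N).1, z)).2.
Proof.
move=> e0.
have [D [asg [K [rho [rho0 cK KG asgD asgK]]]]] :=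
  finite_compact_cover total_compact coord_proj_near.
pose D2 := [seq (a, b) | a <- D, b <- D].
have D2P a b : a \in D -> b \in D -> (a, b) \in D2 by exact: allpairs_f.
pose mu := expR (- (lambda / 2)).
have mu0 : 0 < mu by exact: expR_gt0.
have mu1 : mu < 1 by rewrite -expR0 ltr_expR oppr_lt0 divr_gt0.
have mu2 : mu ^+ 2 = expR (- lambda).
  by rewrite /mu -expRM_natl; congr expR; field.
have [C C0 [HC HD]] : exists2 C, 0 < C &
    (forall a, a \in D -> forall p, K a p -> bounded_by a C p) /\
    (forall a b, a \in D -> b \in D -> forall p, K a p -> K b (Theta p) -> forall v,
      `|coord_deriv a b p v| <= C * `|v|).
  have [||r1 r10 H1] := @seq_uniform _ _ D (fun r a => forall p, K a p -> bounded_by a r^-1 p).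
  - move=> r s a r0 rs H p Kp; apply: bounded_by_le (H p Kp).
    by rewrite lef_pV2// posrE// (lt_le_trans r0).
  - by move=> a _; apply: uniform_bounds; [exact: (cK a).1|exact: KG].
  have [||r2 r20 H2] := @seq_uniform _ _ D2 (fun r ab => forall p, K ab.1 p ->
      K ab.2 (Theta p) -> forall v, `|coord_deriv ab.1 ab.2 p v| <= r^-1 * `|v|).
  - move=> r s a r0 rs H p Kp KTp v; apply: (le_trans (H p Kp KTp v)).
    by apply: ler_wpM2r => //; rewrite lef_pV2// posrE// (lt_le_trans r0).
  - move=> [a b] _; have [r r0 Hr] := uniform_deriv_bound (cK a).1 (cK b).2 (KG a) (KG b).
    by exists r => // p Kp KTp; exact: Hr.
  have i1 : 0 < r1^-1 by rewrite invr_gt0.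
  have i2 : 0 < r2^-1 by rewrite invr_gt0.
  exists (r1^-1 + r2^-1); first by rewrite addr_gt0.
  split=> [a aD p Kp|a b aD bD p Kp KTp v].
    by apply: bounded_by_le (H1 a aD p Kp); rewrite lerDl ltW.
  apply: (le_trans (H2 (a, b) (D2P _ _ aD bD) p Kp KTp v)).
  by apply: ler_wpM2r => //; rewrite lerDr ltW.
pose Kg : R := green_bound C mu.
have Kg0 : 0 < Kg by exact: green_bound_gt0.
pose m : R := C ^+ 2 * (2 * C + 1).
(* [finite_shadowing] tolerates 1/2 in total: a quarter for replacing the derivative by its splice,
   a quarter for the nonlinearity [eta]. *)
have [t [t0 t1 tm tK]] : exists t, [/\ 0 < t, t <= 1,
    t * (2 * mu^-1 * m + 1 + m) <= mu^-1 - 1 &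
    Kg * (t * (2 * C + 1) * C) <= 1 / 4].
  have C1 : 0 < 2 * C + 1 by rewrite addr_gt0// mulr_gt0.
  have m0 : 0 < m by rewrite mulr_gt0// exprn_gt0.
  have L0 : 0 < 2 * mu^-1 * m + 1 + m by rewrite !addr_gt0// !mulr_gt0// invr_gt0.
  have B0 : 0 < Kg * ((2 * C + 1) * C) by exact: mulr_gt0 Kg0 (mulr_gt0 C1 C0).
  have c0 : 0 < mu^-1 - 1 by rewrite subr_gt0 invf_gt1.
  have [t [t0 t1 tL tB]] := small_factor L0 B0 c0.
  exists t; split => //.
  by rewrite (_ : _ * _ = Kg * ((2 * C + 1) * C) * t); [exact: tB|ring].
have [eta eta0 etaK] : exists2 eta, 0 < eta & Kg * (n%:R * eta) <= 1 / 4.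
  have n0 : 0 < n%:R + 1 :> R by rewrite ltr_wpDl.
  exists (1 / 4 / (Kg * (n%:R + 1))); first by rewrite !divr_gt0// mulr_gt0.
  rewrite [leLHS](_ : _ = n%:R / (n%:R + 1) * (1 / 4)); last by field; rewrite !gt_eqF.
  by rewrite ler_piMl// ler_pdivrMr// mul1r lerDl.
have [r r0 [Hinv Hmap]] : exists2 r, 0 < r &
    (forall a, a \in D -> forall p, K a p -> forall v, `|v| <= r ->
      chart_cod (base_chart a) (base_chart a p.2 + v) /\
      ball p.2 e (chart_inv (base_chart a) (base_chart a p.2 + v))) /\
    (forall a b, a \in D -> b \in D -> forall p, K a p -> K b (Theta p) ->
      (forall v, `|v| <= r ->
        inside b (p.1, F p.1 (chart_inv (base_chart a) (base_chart a p.2 + v)))) /\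
      forall u v, `|u| <= r -> `|v| <= r ->
        `|coord_map a b p.1 (base_chart a p.2 + u) - coord_map a b p.1 (base_chart a p.2 + v) -
          coord_deriv a b p (u - v)| <= n%:R * eta * `|u - v|).
  have [||r1 r10 H1] := @seq_uniform _ _ D (fun r a => forall p, K a p -> forall v, `|v| <= r ->
      chart_cod (base_chart a) (base_chart a p.2 + v) /\
      ball p.2 e (chart_inv (base_chart a) (base_chart a p.2 + v))).
  - by move=> r s a r0 rs H p Kp v vr; apply: H => //; exact: le_trans rs.
  - by move=> a _; exact: (uniform_inverse (cK a).1 (KG a) e0).
  have [||r2 r20 H2] := @seq_uniform _ _ D2 (fun r ab => forall p, K ab.1 p -> K ab.2 (Theta p) ->
      (forall v, `|v| <= r ->
        inside ab.2 (p.1, F p.1 (chart_inv (base_chart ab.1) (base_chart ab.1 p.2 + v)))) /\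
      forall u v, `|u| <= r -> `|v| <= r ->
        `|coord_map ab.1 ab.2 p.1 (base_chart ab.1 p.2 + u) -
          coord_map ab.1 ab.2 p.1 (base_chart ab.1 p.2 + v) -
          coord_deriv ab.1 ab.2 p (u - v)| <= n%:R * eta * `|u - v|).
  - move=> r s a r0 rs H p Kp KTp; have [h1 h2] := H p Kp KTp.
    split=> [v vr|u v ur vr]; first by apply: h1; exact: le_trans rs.
    by apply: h2; exact: le_trans rs.
  - move=> [a b] _; have [r r0 Hr] :=
      uniform_nonlinearity (cK a).1 (cK b).2 (KG a) (KG b) eta0.
    by exists r => // p Kp KTp; exact: Hr.
  exists (Num.min r1 r2); first by rewrite lt_min r10.
  split=> [a aD p Kp v|a b aD bD p Kp KTp].
    by rewrite le_min => /andP[vr _]; exact: H1.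
  have [h1 h2] := H2 (a, b) (D2P _ _ aD bD) p Kp KTp.
  split=> [v|u v]; rewrite !le_min => /andP[_ ur]; first exact: h1.
  by move=> /andP[_ vr]; exact: h2.
(* The largest jump in coordinates allowed by [Kg * d <= r / 2]. *)
pose d : R := r / 2 / Kg.
have d0 : 0 < d by rewrite /d divr_gt0// divr_gt0.
have [delta delta0 [dr Hvar Hchart]] : exists2 delta, 0 < delta &
    [/\ delta <= rho,
      (forall a, a \in D -> forall p q, K a p -> ball p delta q -> forall v,
        `|coord_proj a q v - coord_proj a p v| <= t * `|v| /\
        (coord_norm a q v <= (1 + t) * coord_norm a p v /\
         coord_norm a p v <= (1 + t) * coord_norm a q v)) &
      (forall a, a \in D -> forall p q, K a p -> ball p delta q ->
        inside a q /\ `|base_chart a q.2 - base_chart a p.2| <= d)].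
  have [||r1 r10 H1] := @seq_uniform _ _ D (fun r a => forall p q, K a p -> ball p r q -> forall v,
        `|coord_proj a q v - coord_proj a p v| <= t * `|v| /\
        (coord_norm a q v <= (1 + t) * coord_norm a p v /\
         coord_norm a p v <= (1 + t) * coord_norm a q v)).
  - by move=> r' s a r'0 rs H p q Kp pq; apply: H => //; exact: le_ball pq.
  - by move=> a _; exact: (uniform_variation (cK a).1 (KG a) t0 t1).
  have [||r2 r20 H2] := @seq_uniform _ _ D (fun r a => forall p q, K a p -> ball p r q ->
        inside a q /\ `|base_chart a q.2 - base_chart a p.2| <= d).
  - by move=> r' s a r'0 rs H p q Kp pq; apply: H => //; exact: le_ball pq.
  - by move=> a _; exact: (uniform_chart (cK a).1 (KG a) d0).
  exists (Num.min rho (Num.min r1 r2)); first by rewrite !lt_min rho0 r10.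
  split; first by rewrite ge_min lexx.
    move=> a aD p q Kp pq; apply: H1 => //; apply: le_ball pq.
    by rewrite !ge_min lexx orbT.
  move=> a aD p q Kp pq; apply: H2 => //; apply: le_ball pq.
  by rewrite !ge_min lexx !orbT.
exists delta => // p p1 pT N.
pose a k := asg (p k).
have aD k : a k \in D by exact: asgD.
have Kp k : K (a k) (p k) by apply: asgK; exact: ballxx.
(* Since [delta <= rho], the chart assigned to [p k.+1] also serves at [Theta (p k)], so both sides
   of the jump are read in one chart. *)
have KT k : K (a k.+1) (Theta (p k)).
  by apply: asgK; apply: ball_sym; apply: le_ball (pT k).
have ip k : inside (a k) (p k) by have [] := KG _ _ (Kp k).
have iT k : inside (a k.+1) (Theta (p k)) by have [] := KG _ _ (KT k).
pose Pk k := coord_proj (a k) (p k).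
pose Tk k := coord_proj (a k.+1) (Theta (p k)).
pose Dk k := coord_deriv (a k) (a k.+1) (p k).
pose Qk k := splice (Tk k) (Pk k.+1).
pose Ak k := (Qk k \o Dk k)%VF.
pose nuk k := coord_norm (a k) (p k).
pose base k : V := base_chart (a k) (p k).2.
(* The fiber map recentred at the pseudo-orbit: [f k 0] is the jump in coordinates, and a solution
   of [f k (v k) = v k.+1] is a true orbit. *)
pose f k (v : V) : V := coord_map (a k) (a k.+1) (p k).1 (base k + v) - base k.+1.
have [v [vr vS]] : exists v : nat -> V, (forall k, (k <= N)%N -> `|v k| <= r) /\
    forall k, (k < N)%N -> f k (v k) = v k.+1.
  have projP k w : Pk k (Pk k w) = Pk k w by exact: coord_proj_proj.
  have projT k w : Tk k (Tk k w) = Tk k w by exact: coord_proj_proj.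
  have bP k w := HC _ (aD k) _ (Kp k) w.
  have bT k w := HC _ (aD k.+1) _ (KT k) w.
  have vT k w := Hvar _ (aD k.+1) _ _ (KT k) (pT k) w.
  have triangle b q (u w : V) : coord_norm b q (u + w) <= coord_norm b q u + coord_norm b q w.
    exact: chart_norm_triangle.
  have T_le k w : `|Tk k w| <= C * `|w| by have [] := bT k w.
  have QT_le k w : `|Pk k.+1 w - Tk k w| <= t * `|w| by have [] := vT k w.
  have nuT_ge k w : `|w| <= C * coord_norm (a k.+1) (Theta (p k)) w by have [] := bT k w.
  have nu_le k w : nuk k w <= C * `|w| by have [] := bP k w.
  have nuT k w := (vT k w).2.
  apply: (@finite_shadowing R n Pk Ak nuk C mu _ _ _ _ _ _ _ _ _ _ _ f r
    (n%:R * eta + t * (2 * C + 1) * C) d N).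
  - exact: C0.
  - exact: ltW.
  - exact: mu1.
  - exact: projP.
  - by move=> k w; have [] := bP k w.
  - by move=> k u w; exact: triangle.
  - by move=> k w; have [] := bP k w.
  - exact: nu_le.
  - move=> k w Pw; apply: (splice_stable (projT k) (projP k.+1) (T_le k) (QT_le k)
      (triangle _ _) (nuT_ge k) (nu_le k.+1) (nuT k) C0 mu0 (ltW t0) tm _ Pw).
    by rewrite mu2; exact: coord_stable (ip k) (iT k).
  - move=> k w Pw; apply: (splice_unstable (projT k) (projP k.+1) (T_le k) (QT_le k)
      (triangle _ _) (nuT_ge k) (nu_le k.+1) (nuT k) C0 mu0 (ltW t0) t1 tm _ Pw).
    by rewrite mu2; exact: coord_unstable (ip k) (iT k).
  - move=> k w Pw; apply: (splice_unstable_onto (projT k) (projP k.+1) (T_le k) (QT_le k)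
      (triangle _ _) (nuT_ge k) (nu_le k.+1) (nuT k) C0 mu0 (ltW t0) t1 tm _ Pw).
    exact: coord_unstable_onto (ip k) (iT k).
  - exact: ltW.
  - by rewrite addr_ge0// !mulr_ge0 ?addr_ge0 ?mulr_ge0 ?(ltW t0) ?(ltW C0) ?(ltW eta0).
  - by rewrite mulrDr; apply: (le_trans (lerD etaK tK)); lra.
  - by rewrite /d mulrC divfK// gt_eqF.
  - move=> k u w ur wr.
    have [_ H] := Hmap _ _ (aD k) (aD k.+1) _ (Kp k) (KT k).
    have h1 := H _ _ ur wr.
    have h2 := splice_near (projT k) (T_le k) (QT_le k) (ltW t0) (Dk k (u - w)).
    have h3 : t * (2 * C + 1) * `|Dk k (u - w)| <= t * (2 * C + 1) * (C * `|u - w|).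
      apply: ler_wpM2l; last exact: HD.
      by rewrite mulr_ge0 ?(ltW t0)// addr_ge0// mulr_ge0 ?(ltW C0).
    (* The first term is the nonlinearity of the fiber map, the second the distance from [Qk k] to
       the identity. *)
    have -> : f k u - f k w - Ak k (u - w) =
        (coord_map (a k) (a k.+1) (p k).1 (base k + u) -
         coord_map (a k) (a k.+1) (p k).1 (base k + w) - Dk k (u - w)) -
        (Qk k (Dk k (u - w)) - Dk k (u - w)).
      have Z (x y b q w' : V) : x - b - (y - b) - q = (x - y - w') - (q - w').
        by apply/rowP => i; rewrite !mxE; ring.
      have -> : Ak k (u - w) = Qk k (Dk k (u - w)) by rewrite /Ak comp_lfunE.
      exact: Z.
    apply: (le_trans (ler_normB _ _)); rewrite mulrDl; apply: lerD => //.
    by apply: (le_trans h2); rewrite -[leRHS]mulrA.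
  - move=> k; rewrite /f addr0 /coord_map /= (chart_mapK (ip k)) distrC.
    have [_] := Hchart _ (aD k.+1) _ _ (KT k) (pT k).
    by rewrite distrC.
have zP k : (k <= N)%N -> iter k Theta ((p 0%N).1,
    chart_inv (base_chart (a 0%N)) (base 0%N + v 0%N)) =
    ((p k).1, chart_inv (base_chart (a k)) (base k + v k)).
  elim: k => [//|k IH] kN; rewrite iterS IH ?(ltnW kN)// /Defs.skew/= -p1.
  congr pair; rewrite -(vS _ kN) /f subrKC /coord_map /=.
  rewrite chart_mapK//.
  have [H _] := Hmap _ _ (aD k) (aD k.+1) _ (Kp k) (KT k).
  exact: (H _ (vr _ (ltnW kN))).
exists (chart_inv (base_chart (a 0%N)) (base 0%N + v 0%N)) => k kN.
rewrite zP//=.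
by have [] := Hinv _ (aD k) _ (Kp k) _ (vr _ kN).
Qed.

Lemma pseudo_orbit_shadowing_infinite e : 0 < e -> exists2 delta, 0 < delta &
  forall p : nat -> X, (forall k, (p k.+1).1 = theta (p k).1) ->
    (forall k, ball (Theta (p k)) delta (p k.+1)) ->
    exists z, forall k, ball (p k).2 e (iter k Theta ((p 0%N).1, z)).2.
Proof.
move=> e0; have e2 : 0 < e / 2 by rewrite divr_gt0.
have [delta delta0 H] := pseudo_orbit_shadowing e2.
exists delta => // p p1 pT.
have iter_cont k := continuous_iter (k := k) skew_continuous.
apply: (compact_shadowing M_compact _ e0 (H p p1 pT)) => k.
exact: continuous_comp_snd (iter_cont k).
Qed.

End Fibers.

(** * Oscillation of Birkhoff averages *)

Section Cesaro.
Context (R : realType).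
Implicit Types (u w : nat -> R) (B e : R).

Definition cesaro u m : R := m%:R^-1 * \sum_(0 <= i < m) u i.

(** Each unit shift exchanges two terms only. *)
Lemma sum_shift_le u B n m : (forall i, `|u i| <= B) ->
  `|\sum_(0 <= i < m) u (n + i)%N - \sum_(0 <= i < m) u i| <= 2 * B * n%:R.
Proof.
move=> uB; elim: n => [|n IH]; first by rewrite subrr normr0 mulr0.
have -> : \sum_(0 <= i < m) u (n.+1 + i)%N =
    \sum_(0 <= i < m) u (n + i)%N + (u (n + m)%N - u n).
  have := telescope_sumr (fun i => u (n + i)%N) (leq0n m); rewrite addn0 => <-.
  rewrite -big_split/=; apply: eq_bigr => i _; rewrite addSn addnS; ring.
rewrite addrAC (le_trans (ler_normD _ _))// -[n.+1]addn1 natrD mulrDr mulr1 lerD//.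
by rewrite (le_trans (ler_normB _ _))// mulr_natl mulr2n lerD.
Qed.

Lemma cesaro_close u w B e n k m : (0 < m)%N ->
  (forall i, `|u i| <= B) -> (forall i, `|w i| <= B) ->
  (forall j, `|u (n + j)%N - w (k + j)%N| <= e) ->
  `|cesaro u m - cesaro w m| <= e + 2 * B * (n + k)%:R / m%:R.
Proof.
move=> m0 uB wB uw; have m0' : 0 < m%:R :> R by rewrite ltr0n.
rewrite /cesaro -mulrBr normrM normfV (ger0_norm (ltW m0')) ler_pdivrMl//.
have -> : m%:R * (e + 2 * B * (n + k)%:R / m%:R) = m%:R * e + 2 * B * (n + k)%:R.
  by field; rewrite gt_eqF.
have h1 := sum_shift_le n m uB; have h2 := sum_shift_le k m wB.
have h3 : `|\sum_(0 <= i < m) u (n + i)%N - \sum_(0 <= i < m) w (k + i)%N| <= m%:R * e.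
  rewrite -sumrB (le_trans (ler_norm_sum _ _ _))//.
  rewrite (le_trans (ler_sum _ (fun i _ => uw i)))// big_const_nat subn0 iter_addr_0.
  by rewrite mulr_natl.
rewrite natrD mulrDr; move: h1 h2 h3; rewrite !ler_norml.
set a := \sum_(0 <= i < m) u i; set b := \sum_(0 <= i < m) w i.
move=> /andP[h1 h1'] /andP[h2 h2'] /andP[h3 h3']; apply/andP; split; lra.
Qed.

Lemma cvgn_cauchyP (a : nat -> R) : cvgn a <->
  forall e, 0 < e -> exists N, forall m m', (N <= m)%N -> (N <= m')%N -> `|a m - a m'| < e.
Proof.
split=> [/cvg_ex[l al] e e0|H].
  have e2 : 0 < e / 2 by rewrite divr_gt0.
  have /cvgrPdist_lt/(_ _ e2)[N _ NP] := al; exists N => m m' Nm Nm'.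
  rewrite [e]splitr -(subrKA l) (le_lt_trans (ler_normD _ _))// ltrD//.
    by rewrite distrC; exact: NP.
  exact: NP.
apply/cauchy_cvgP/cauchy_ballP => e e0; have [N NP] := H e e0.
exists ([set x | exists2 m, (N <= m)%N & a m = x], [set x | exists2 m, (N <= m)%N & a m = x]).
  by split; exists N => // m Nm; exists m.
by move=> [x y] /= [[m Nm <-] [m' Nm' <-]]; exact: NP.
Qed.

(** [e] precedes the shifts [n] and [k]: the mixing time, which enters both, is known only after the
    shadowing precision. *)
Lemma cesaro_irregular w B : (forall i, `|w i| <= B) -> ~ cvgn (cesaro w) ->
  exists2 e, 0 < e & forall u n k, (forall i, `|u i| <= B) ->
    (forall j, `|u (n + j)%N - w (k + j)%N| <= e) -> ~ cvgn (cesaro u).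
Proof.
move=> wB nw.
have [e0 [e00 He0]] : exists e, 0 < e /\ ~ exists N, forall m m', (N <= m)%N -> (N <= m')%N ->
    `|cesaro w m - cesaro w m'| < e.
  apply: contrapT => H; apply: nw; apply/cvgn_cauchyP => e e0.
  by apply: contrapT => nH; apply: H; exists e.
(* Pointwise closeness and the shifts each cost [e0 / 8], so the averages of [u] and [w] are
   [e0 / 4] apart. Used twice, with a Cauchy bound [e0 / 4] for [u], this stays below [e0]. *)
exists (e0 / 8); first by rewrite divr_gt0.
move=> u n k uB uw /cvgn_cauchyP/(_ (e0 / 4)) []; first by rewrite divr_gt0.
move=> N NP; apply: He0.
have B0 : 0 <= B by rewrite (le_trans _ (wB 0%N)).
pose c := 2 * B * (n + k)%:R; have c0 : 0 <= c by rewrite !mulr_ge0.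
have e8 : 0 < e0 / 8 by rewrite divr_gt0.
pose N1 := (Num.truncn (c / (e0 / 8))).+1.
have small m : (N1 <= m)%N -> c / m%:R <= e0 / 8.
  move=> Nm; have m0 : 0 < m%:R :> R by rewrite ltr0n (leq_trans _ Nm).
  rewrite ler_pdivrMr// mulrC -ler_pdivrMr// (le_trans (ltW (truncnS_gt _)))//.
  by rewrite ler_nat.
have close m : (N1 <= m)%N -> `|cesaro u m - cesaro w m| <= e0 / 4.
  move=> Nm; have m0 : (0 < m)%N by exact: leq_trans Nm.
  by have := cesaro_close m0 uB wB uw; have := small m Nm; rewrite -/c; lra.
exists (maxn N N1) => m m'; rewrite !geq_max => /andP[Nm N1m] /andP[Nm' N1m'].
have := close m N1m; have := close m' N1m'; have := NP m m' Nm Nm'.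
rewrite !ltr_norml !ler_norml => /andP[h1 h2] /andP[h3 h4] /andP[h5 h6].
by apply/andP; split; lra.
Qed.

End Cesaro.

(** * Transition by mixing and conclusion *)

Lemma mixing_uniform (R : realType) (M : metricType R) (n : nat)
    (S : smooth_structure R M n) (Omega : pmetricType R) (theta : Omega -> Omega)
    (F : Omega -> diff2 S) (U : set M) (d : R) :
  compact [set: M] -> mixing_on_fibers theta F -> open U -> U !=set0 -> 0 < d ->
  exists2 m : nat, (0 < m)%N & forall omega x, exists2 y, U y &
    ball x d (iter m (Defs.skew theta F) (omega, y)).2.
Proof.
move=> /compact_near_coveringP cM mix oU U0 d0; have d2 : 0 < d / 2 by rewrite divr_gt0.
have [|N _ NP] := cM _ \oo (fun m x => forall omega, exists2 y, U y &
    ball x d (iter m (Defs.skew theta F) (omega, y)).2) _.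
  move=> x _; have [N _ NP] := mix U (interior (ball x (d / 2))) oU U0
    (@open_interior _ _) (ex_intro _ x (nbhsx_ballx x _ d2)).
  exists (ball x (d / 2), [set m | (N <= m)%N]).
    by split => //=; [exact: nbhsx_ballx|exists N].
  move=> [x' m] /= [xx' Nm] omega.
  have [q [[[w y] [/= -> Uy] yq] [_ qV]]] := NP m Nm omega.
  exists y => //; rewrite yq [d]splitr.
  by apply: ball_triangle (ball_sym xx') _; exact: interior_subset qV.
(* The time must be positive for the spliced pseudo-orbit to start in [U]. *)
by exists N.+1 => // omega x; apply: NP => //=.
Qed.

Lemma compact_bounded (R : realType) (X : topologicalType) (phi : X -> R) :
  compact [set: X] -> continuous phi -> exists B, forall x, `|phi x| <= B.
Proof.
move=> cX cphi.
have [|x _|r r0 H] := @compact_uniform R X setT (fun r p => `|phi p| <= r^-1) cX.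
- move=> r s x r0 rs /le_trans; apply.
  by rewrite lef_pV2// posrE (lt_le_trans r0).
- have x0 : 0 < `|phi x| + 1 by rewrite ltr_wpDl.
  exists (`|phi x| + 1)^-1; first by rewrite invr_gt0.
  rewrite invrK; have /cvgrPdist_lt/(_ 1 ltr01) := cphi x.
  apply: filterS => y /ltW xy.
  rewrite -[phi y](subrK (phi x)) addrC (le_trans (ler_normD _ _))//.
  by rewrite lerD2l distrC.
by exists r^-1 => x; exact: H.
Qed.

Lemma uniformly_continuous (R : realType) (X : pseudoMetricType R) (phi : X -> R) e :
  compact [set: X] -> continuous phi -> 0 < e ->
  exists2 d, 0 < d & forall x y, ball x d y -> `|phi x - phi y| <= e.
Proof.
move=> cX cphi e0; have e2 : 0 < e / 2 by rewrite divr_gt0.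
have [x _|r r0 H] := @compact_uniform_pair R X setT (fun x y => `|phi x - phi y| <= e) cX.
  have /cvgrPdist_lt/(_ _ e2) nN := cphi x.
  exists [set y | `|phi x - phi y| < e / 2] => // y z /= xy xz.
  rewrite [e]splitr -(subrKA (phi x)) (le_trans (ler_normD _ _))// lerD ?ltW//.
  by rewrite distrC.
by exists r => // x y; exact: H.
Qed.

Lemma skew_iter1 (R : realType) (M : metricType R) (n : nat)
    (S : smooth_structure R M n) (Omega : pmetricType R) (theta : Omega -> Omega)
    (F : Omega -> diff2 S) k p : (iter k (Defs.skew theta F) p).1 = iter k theta p.1.
Proof. by elim: k => //= k ->. Qed.

(** The only jump is at [j.+1 = m]; elsewhere a true orbit is followed. *)
Lemma pseudo_orbit_splice (T : Type) (f : T -> T) (q0 q1 : T) m (C : T -> T -> Prop) :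
  (forall x, C x x) -> C (iter m f q1) (iter m f q0) ->
  forall j, C (f (if (j < m)%N then iter j f q1 else iter j f q0))
              (if (j.+1 < m)%N then iter j.+1 f q1 else iter j.+1 f q0).
Proof.
move=> C_refl Cm j; case: (ltngtP j.+1 m) => [jm|mj|jm].
- exact: C_refl.
- exact: C_refl.
- by move: Cm; rewrite -jm.
Qed.

Theorem corollary3 (R : realType)
  (n : nat) (M : metricType R) (S : smooth_structure R M n)
  (g : riemannian_metric S)
  (Omega : pmetricType R) (theta : Omega -> Omega)
  (P : probability (borel Omega) R)
  (F : Omega -> diff2 S)
  (M_connected : connected [set: M])
  (M_compact : compact [set: M])
  (M_dist : forall x y : M, mdist x y = riemannian_distance g x y)
  (Omega_compact : compact [set: Omega])
  (theta_homeo : homeomorphism theta)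
  (theta_ue : uniquely_ergodic theta P)
  (F_continuous : continuous F)
  (F_anosov : anosov_on_fibers g theta F)
  (F_mixing : mixing_on_fibers theta F)
  (P_full : forall U : set Omega, open U -> U !=set0 -> (0 < P U)%E)
  (phi : Omega * M -> R) (phi_continuous : continuous phi) :
  irregular_set theta F phi = set0 \/ dense (irregular_set theta F phi).
Proof.
have [|] := pselect (irregular_set theta F phi = set0); first by left.
move/eqP/set0P => [p0 irr0]; right => O [[w1 x1] Op1] oO.
have [Es [Eu [lambda [[cEs cEu] dE iE lambda0 hyp]]]] := F_anosov.
have ctheta : continuous theta by case: theta_homeo.
have cX : compact [set: Omega * M] by rewrite -setXTT; exact: compact_setX.
have [[A B] /= [nA nB] AB] : nbhs (w1, x1) O by exact: open_nbhs_nbhs.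
have [k kA] := uniquely_ergodic_minimal Omega_compact theta_homeo theta_ue P_full p0.1
  (@open_interior _ A) (ex_intro _ w1 nA).
have [e1 /= e10 e1B] : nbhs_ball x1 B by rewrite nbhs_ballE.
have [b phib] := compact_bounded cX phi_continuous.
pose Theta := Defs.skew theta F.
have Theta1 j q : (iter j Theta q).1 = iter j theta q.1 := skew_iter1 _ _ _ _.
have [e e0 He] := cesaro_irregular (fun i => phib (iter i Theta p0)) irr0.
have [e2 e20 He2] := uniformly_continuous cX phi_continuous e0.
(* [e2] preserves the oscillation of the averages; [e1 / 2] keeps the shadowing point in the ball
   around [x1], the other half being spent on [y]. *)
have eps0 : 0 < Num.min e2 (e1 / 2) by rewrite lt_min e20 divr_gt0.
have [delta delta0 shadow] := pseudo_orbit_shadowing_infinite cEs cEu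
  (fun p => let: And4 a b _ _ := dE p in conj a b) (fun p => (iE p).1) (fun p => (iE p).2)
  (fun p => (hyp p).1) (fun p => (hyp p).2) M_compact Omega_compact F_continuous ctheta
  lambda0 eps0.
have U0 : (interior (ball x1 (e1 / 2))) !=set0.
  by exists x1; apply: nbhsx_ballx; rewrite divr_gt0.
have [m m0 mix] := mixing_uniform M_compact F_mixing (@open_interior _ _) U0 delta0.
pose q0 := iter k Theta p0.
(* The target is where [q0] is at time [m], over the same base point, so the jump takes place within
   a fiber. *)
have [y Uy yq] := mix q0.1 (iter m Theta q0).2.
pose q1 := (q0.1, y).
(* Follow the orbit of [q1] for [m] steps, then jump to the orbit of [q0]. *)
pose p j := if (j < m)%N then iter j Theta q1 else iter j Theta q0.
have p_fst j : (p j).1 = iter j theta q0.1.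
  by rewrite /p; case: ifP => _; rewrite skew_iter1.
have p_shift j : (p j.+1).1 = theta (p j).1 by rewrite !p_fst.
have p_pseudo j : ball (Theta (p j)) delta (p j.+1).
  apply: (pseudo_orbit_splice (C := fun x y => ball x delta y)) => [x|].
    exact: ball_center (PosNum delta0).
  split; last exact: ball_sym.
  have -> : (iter m Theta q0).1 = (iter m Theta q1).1.
    exact: etrans (Theta1 m q0) (esym (Theta1 m q1)).
  exact: ball_center (PosNum delta0).
have [z zP] := shadow p p_shift p_pseudo.
have p0E : (p 0%N).1 = q0.1 by rewrite p_fst.
exists (q0.1, z); split.
  apply: AB; split => /=.
    by apply: interior_subset; rewrite skew_iter1.
  apply: e1B; rewrite [e1]splitr; apply: (ball_triangle (interior_subset Uy)).
  have := zP 0%N; rewrite /p m0 /=.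
  by apply: le_ball; rewrite ge_min lexx orbT.
(* From time [m] on, the new orbit follows that of [p0] from time [k + m]. *)
apply: (He (fun i => phi (iter i Theta (q0.1, z))) m (k + m)%N) => [i|j]; first exact: phib.
rewrite distrC; apply: He2.
have -> : iter (k + m + j)%N Theta p0 = iter (m + j)%N Theta q0.
  by rewrite /q0 -iterD [(m + j + k)%N]addnC addnA.
split.
  have -> : (iter (m + j)%N Theta q0).1 = (iter (m + j)%N Theta (q0.1, z)).1.
    exact: etrans (Theta1 _ q0) (esym (Theta1 _ (q0.1, z))).
  exact: ball_center (PosNum e20).
have := zP (m + j)%N; rewrite /p ltnNge leq_addr /= p0E.
by apply: le_ball; rewrite ge_min lexx.
Qed.
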